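(* There exists a constant $c>0$ such that for all integers $n\geq 1$, $$\mathbf{E}(\tau_{\mathfrak{S}_n})\leq c ,$$ where $\mathfrak{S}_n$ is the symmetric group on $n$ letters and $\tau_{\mathfrak{S}_n}$ is the number of independently, randomly chosen conjugacy classes of $\mathfrak{S}_n$ (each class being chosen with probability proportional to its size) that one must pick before ensuring that any tuple of elements taken from each of these classes generates $\mathfrak{S}_n$. In fact, for any integer $k\geq 1$, there exists $c_k\geq 0$ such that $\mathbf{E}(\tau_{\mathfrak{S}_n}^k)\leq c_k$ for all $n\geq 1$.
   Context: For a finite group $G$, a tuple $(C_1,\ldots,C_m)$ of conjugacy classes of $G$ is said to generate $G$ if, for every choice of representatives $g_i\in C_i$ ($1\leq i\leq m$), the elements $g_1,\ldots,g_m$ generate $G$. Let $(X_n)_{n\geq 1}$ be a sequence of independent, uniformly distributed $G$-valued random variables and let $X_n^{\sharp}$ be the conjugacy class of $X_n$. The waiting time is $$\tau_G=\min\{n\geq 1 \mid (X_1^{\sharp},\ldots,X_n^{\sharp})\text{ generates } G\}\in[1,+\infty].$$ (In particular $\tau_G=1$ if $G$ is trivial.) *)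

(* Defs.v *)
From mathcomp Require Import all_boot all_order all_algebra all_fingroup.
From mathcomp Require Import all_classical all_reals all_analysis.

Set Implicit Arguments.
Unset Strict Implicit.
Unset Printing Implicit Defensive.

Local Open Scope classical_set_scope.

(* "for every choice of representatives": the generating sets are
   {g_1, ..., g_m} with g_i ranging over C_i (invariable generation). *)
Definition classes_generate (gT : finGroupType) (m : nat)
    (C : m.-tuple {set gT}) : Prop :=
  forall g : m.-tuple gT, (forall i : 'I_m, tnth g i \in tnth C i) ->
    (<<[set x in g]>> = [set: gT])%g%SET.

Definition conj_class (gT : finGroupType) (x : gT) : {set gT} :=
  (x ^: [set: gT])%g%SET.

(* The finite group gT carries the discrete sigma-algebra, so X is a random
   variable when every preimage is an event. *)
Definition is_random_element d (T : measurableType d) (gT : finGroupType)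
    (X : T -> gT) : Prop :=
  forall A : set gT, measurable (X @^-1` A).

Definition uniformly_distributed (R : realType) d (T : measurableType d)
    (P : probability T R) (gT : finGroupType) (X : T -> gT) : Prop :=
  forall g : gT, P (X @^-1` [set g]) = ((#|gT|%:R)^-1 : R)%:E.

Definition mutually_independent (R : realType) d (T : measurableType d)
    (P : probability T R) (gT : finGroupType) (X : nat -> T -> gT) : Prop :=
  forall (J : seq nat) (A : nat -> set gT), uniq J ->
    P (\bigcap_(j in [set` J]) (X j @^-1` A j)) =
    (\prod_(j <- J) P (X j @^-1` A j))%E.

(* The sequence is indexed from 0: [X i] is the (i+1)-st pick, and the first m
   picks are X 0, ..., X m.-1. *)
Record iid_uniform (R : realType) d (T : measurableType d)
    (P : probability T R) (gT : finGroupType) (X : nat -> T -> gT) : Prop := {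
  iid_random_element : forall i, is_random_element (X i);
  iid_independent : mutually_independent P X;
  iid_uniformly_distributed : forall i, uniformly_distributed P (X i)
}.

(* The minimum over m >= 1 is an infimum in \bar R, so it is +oo when no
   initial segment generates. *)
Definition waiting_time (R : realType) (T : Type) (gT : finGroupType)
    (X : nat -> T -> gT) (w : T) : \bar R :=
  ereal_inf [set (m%:R : R)%:E | m in
    [set m : nat | (1 <= m)%N /\
       classes_generate [tuple conj_class (X i w) | i < m]]].
Arguments waiting_time R {T gT} X w.

(* Main.v *)
Require Import Defs.
From mathcomp Require Import all_boot all_order all_algebra all_fingroup.
From mathcomp Require Import ring lra zify.

(* It suffices to find m and eps > 0, independent of n, such that m random
   permutations invariably generate S_n with probability at least eps: disjoint
   blocks of m picks are independent, so the waiting time has geometric tails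
   and hence bounded moments.

   Take m = 64. Suppose that the first permutation has no cycle of length at
   most K, the second has a fixed point and no other cycle of length at most K,
   and, for each k with K < k <= n/2, one of 60 further permutations, all having
   fixed points, leaves no k-set invariant. Then any group G containing
   conjugates of these permutations is 2-transitive. If in addition G contains a
   nontrivial element moving fewer than about sqrt n points, then some conjugate
   of it shares exactly one moved point with it, and the commutator of the two
   is a 3-cycle. Hence G is the alternating group, or S_n as soon as it has an
   odd element.

   All the probabilities follow from the identity
     sum_s prod_(C cycle of s) w |C| = n! * [x^n] exp (sum_j w j * x^j / j)
   for suitable weights w. The probability that a permutation has an invariant
   k-set is O(k^(-1/30)), so the union bound over k converges for 60
   permutations. A power moving few points comes from a permutation with exactly
   one cycle of length divisible by 2^a, with 2^a of order log n, that cycle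
   having length at most sqrt n. For the finitely many small n, every
   permutation is picked at least once with positive probability, and by Jordan
   a subgroup meeting all conjugacy classes is the whole group. *)

Set Implicit Arguments.
Unset Strict Implicit.
Unset Printing Implicit Defensive.

(** * 2-transitive groups with an odd element and an element of small support *)

Section MovedPoints.

Local Open Scope group_scope.

Variable T : finType.
Implicit Types (s h g : {perm T}) (a b c x y z : T) (G : {group {perm T}}).

Definition moved s : {set T} := [set x | s x != x].

Lemma moved_perm s x : (s x \in moved s) = (x \in moved s).
Proof. by rewrite !inE (inj_eq perm_inj). Qed.

Lemma movedV s : moved s^-1 = moved s.
Proof. by apply/setP=> x; rewrite !inE -(inj_eq (@perm_inj _ s)) permKV eq_sym. Qed.

Lemma moved_permV s x : (s^-1 x \in moved s) = (x \in moved s).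
Proof. by rewrite -moved_perm permKV. Qed.

Lemma movedJ s g : moved (s ^ g) = g @: moved s.
Proof.
apply/setP=> x; rewrite -{1}(permKV g x) inE permJ (inj_eq perm_inj).
apply/idP/imsetP=> [sx|[y]]; last by rewrite inE => sy ->; rewrite permK.
by exists (g^-1 x); rewrite ?inE // permKV.
Qed.

(** Products act from left to right, so the right-hand side is the 3-cycle a -> h a -> s a -> a.
    Away from [a] the supports are disjoint, so the commutator fixes every point other than these
    three. *)
Lemma commg_moved s h a :
  moved s :&: moved h = [set a] -> [~ s, h] = tperm a (h a) * tperm a (s a).
Proof.
move=> sha; have inI x : (x \in moved s) && (x \in moved h) = (x == a).
  by rewrite -in_setI sha inE.
have /andP[sa ha] : (a \in moved s) && (a \in moved h) by rewrite inI.
have sE x : x \in moved h -> x != a -> s x = x.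
  by move=> hx; apply: contraNeq => sx; rewrite -inI inE sx.
have hE x : x \in moved s -> x != a -> h x = x.
  by move=> sx; apply: contraNeq => hx; rewrite -inI sx inE.
have sVE x : x \in moved h -> x != a -> s^-1 x = x.
  by move=> hx xa; rewrite -{1}(sE x) // permK.
have hVE x : x \in moved s -> x != a -> h^-1 x = x.
  by move=> hx xa; rewrite -{1}(hE x) // permK.
have nsa : s a != a by move: sa; rewrite inE.
have nha : h a != a by move: ha; rewrite inE.
have nsVa : s^-1 a != a by move: sa; rewrite -movedV inE.
have nhVa : h^-1 a != a by move: ha; rewrite -movedV inE.
have nsh : s a != h a.
  apply: contra nsa => /eqP e; rewrite -inI moved_perm sa /=.
  by rewrite e moved_perm ha.
have hsa : h (s a) = s a by rewrite hE ?moved_perm.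
have sha' : s (h a) = h a by rewrite sE ?moved_perm.
apply/permP=> x; rewrite commgEl conjgE !permM.
have [->|xa] := eqVneq x a.
  rewrite tpermL tpermD //; last by rewrite eq_sym.
  by rewrite hVE ?permKV // ?moved_permV.
have [->|xha] := eqVneq x (h a).
  by rewrite tpermR tpermL sVE ?moved_perm // permK hsa.
have [->|xsa] := eqVneq x (s a).
  rewrite [tperm a (h a) _]tpermD // 1?eq_sym // tpermR permK.
  by rewrite sE ?permKV // ?moved_permV.
rewrite !tpermD // 1?eq_sym //.
have [xs|xs] := boolP (x \in moved s).
  rewrite hVE ?permKV ?hE // ?moved_permV //.
  by apply: contra_neq xsa => <-; rewrite permKV.
have sx : s^-1 x = x by move: xs; rewrite -movedV inE negbK => /eqP.
rewrite sx; have [xh|xh] := boolP (x \in moved h).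
  rewrite sE ?permKV // ?moved_permV //.
  by apply: contra_neq xha => <-; rewrite permKV.
have hx : h^-1 x = x by move: xh; rewrite -movedV inE negbK => /eqP.
by rewrite hx -{1}sx permKV -{1}hx permKV.
Qed.

Definition two_transitive G := forall x y u v, x != y -> u != v ->
  exists2 g, g \in G & g x = u /\ g y = v.

Lemma two_transitive_trans G : 2 < #|T| -> two_transitive G ->
  forall x u, exists2 g, g \in G & g x = u.
Proof.
move=> T3 tG x u.
have other (z : T) : exists y, z != y.
  have /card_gt0P[y] : 0 < #|[set~ z]| by rewrite cardsC1 -subn1 subn_gt0 ltnW.
  by rewrite !inE eq_sym => zy; exists y.
have [[y xy] [v uv]] := (other x, other u).
by have [g gG [<- _]] := tG x y u v xy uv; exists g.
Qed.

(* For a fixed [a], the relation "tperm a b * tperm a c \in G" is an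
   equivalence; 2-transitivity gives classes with at least two elements, and
   the commutator of two 3-cycles through [a] merges two classes. *)
Lemma three_cycles_mem G a b c : 2 < #|T| -> two_transitive G ->
  a != b -> a != c -> b != c -> tperm a b * tperm a c \in G ->
  forall x y z, x != y -> x != z -> tperm x y * tperm x z \in G.
Proof.
move=> T3 tG ab ac bc abcG.
have ex3 x y : x != y ->
  exists z, [/\ x != z, y != z & tperm x y * tperm x z \in G].
  move=> xy; have [g gG [gx gy]] := tG a b x y ab xy.
  exists (g c); rewrite -gx -gy !(inj_eq perm_inj); split=> //.
  by rewrite -!tpermJ -conjMg groupJ.
move=> x y z xy xz; pose r u v := tperm x u * tperm x v \in G.
have r_sym u v : r u v -> r v u.
  by rewrite /r -groupV invMg !tpermV.
have r_trans u v w : r u v -> r v w -> r u w.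
  by move=> uv vw; move: (groupM uv vw); rewrite mulgA -(mulgA (tperm x u)) tperm2 mulg1.
rewrite -/(r y z).
have [y' [xy' yy' ry]] := ex3 x y xy.
have [z' [xz' zz' rz]] := ex3 x z xz.
have [->|yz] := eqVneq y z; first by rewrite /r tperm2 group1.
have [yz'|nyz'] := eqVneq y z'; first by apply: r_sym; rewrite yz'.
have [y'z|ny'z] := eqVneq y' z; first by rewrite -y'z.
have [y'z'|ny'z'] := eqVneq y' z'.
  by apply: (r_trans _ y') => //; rewrite y'z'; apply: r_sym.
pose s := tperm x y * tperm x y'; pose h := tperm x z * tperm x z'.
have sE u : u != x -> u != y -> u != y' -> s u = u.
  by move=> ux uy uy'; rewrite permM !tpermD // eq_sym.
have hE u : u != x -> u != z -> u != z' -> h u = u.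
  by move=> ux uy uy'; rewrite permM !tpermD // eq_sym.
have sx : s x = y by rewrite permM tpermL tpermD // eq_sym.
have hx : h x = z by rewrite permM tpermL tpermD // eq_sym.
suff sh : moved s :&: moved h = [set x].
  have : [~ s, h] \in G by rewrite groupR.
  by rewrite (commg_moved sh) sx hx; apply: r_sym.
apply/setP=> u; rewrite !inE; have [->|ux] := eqVneq u x.
  by rewrite sx hx (eq_sym y) (eq_sym z) xy.
apply/negbTE; rewrite negb_and !negbK.
have [->|uy] := eqVneq u y; first by rewrite (hE y) ?eqxx ?orbT // eq_sym.
have [->|uy'] := eqVneq u y'; first by rewrite (hE y') ?eqxx ?orbT // eq_sym.
by rewrite sE ?eqxx.
Qed.

(** All 3-cycles lie in [G], hence so do all products of two transpositions and all even
    permutations. The odd [s] then brings in a transposition. *)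
Lemma two_transitive_full G a b c s : 2 < #|T| -> two_transitive G ->
  a != b -> a != c -> b != c -> tperm a b * tperm a c \in G ->
  s \in G -> odd_perm s -> G :=: [set: {perm T}].
Proof.
move=> T3 tG ab ac bc abcG sG s_odd.
have GT := three_cycles_mem T3 tG ab ac bc abcG.
have Gtt x y u v : x != y -> u != v -> tperm x y * tperm u v \in G.
  move=> xy uv; have [e|xu] := eqVneq x u.
    by rewrite -e; apply: GT => //; rewrite e.
  rewrite -(mulKg (tperm x u) (tperm u v)) tpermV mulgA.
  by apply: groupM; [exact: GT|rewrite (tpermC x u); apply: GT; rewrite // eq_sym].
pose t := tperm a b.
(* The factor [t] makes every partial product of transpositions even, so the induction adds
   transpositions in pairs. *)
have key (g : {perm T}) : (if odd_perm g then t * g else g) \in G.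
  have [ts -> dts] := prod_tpermP g.
  elim: ts dts => [_|[x y] ts IH] /=; first by rewrite big_nil odd_perm1 group1.
  case/andP=> /= xy /IH {}IH; rewrite big_cons /= odd_mul_tperm xy /=.
  case: odd_perm IH => /= IH; last by rewrite mulgA groupM ?Gtt.
  by rewrite -[X in _ * X](mulKg t) tpermV mulgA groupM ?Gtt.
have tG' : t \in G by have := key s; rewrite s_odd groupMr.
apply/setP=> g; rewrite inE; have := key g.
by case: ifP => // _; rewrite groupMl.
Qed.

(** By transitivity on [D] every [N u v] equals |G| / |D|; it remains to sum over [u] and [v] in
    [S]. The action [f] is abstract because points and ordered pairs are both needed. *)
Lemma transitive_average (U : finType) (f : {perm T} -> U -> U) G (D S : {set U}) :
  (forall g h u, f (g * h) u = f h (f g u)) ->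
  (forall g u, u \in D -> f g u \in D) ->
  (forall u v, u \in D -> v \in D -> exists2 g, g \in G & f g u = v) ->
  S \subset D ->
  (#|D| * \sum_(g in G) #|[set u in S | f g u \in S]| = #|S| ^ 2 * #|G|)%N.
Proof.
move=> fM fD trD sSD.
pose N u v := #|[set g in G | f g u == v]|.
have leN u v w : v \in D -> w \in D -> N u v <= N u w.
  move=> vD wD; have [h hG hv] := trD v w vD wD.
  rewrite /N -(card_imset _ (mulIg h)); apply: subset_leq_card.
  apply/subsetP=> _ /imsetP[g + ->]; rewrite !inE => /andP[gG /eqP gu].
  by rewrite groupM //= fM gu hv.
have DN u v : u \in D -> v \in D -> (#|D| * N u v = #|G|)%N.
  move=> uD vD; rewrite -sum_nat_const.
  rewrite (eq_bigr (fun w => \sum_(g in G | f g u == w) 1)%N); last first.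
    move=> w wD; transitivity (N u w); last first.
      by rewrite sum1dep_card; apply: eq_card => g; rewrite !inE.
    by apply/eqP; rewrite eqn_leq !leN.
  rewrite -sum1_card; symmetry.
  by rewrite (partition_big (fun g => f g u) (mem D)) // => g _; apply: fD.
rewrite (eq_bigr (fun g => \sum_(u in S) \sum_(v in S) (f g u == v))%N); last first.
  move=> g _; rewrite -sum1_card.
  rewrite (eq_bigl (fun u => (u \in S) && (f g u \in S))); last by move=> u; rewrite inE.
  rewrite big_mkcondr; apply: eq_bigr => u uS; case: ifP => fS.
    by rewrite (bigD1 (f g u)) //= eqxx big1 // => v /andP[_ ne]; rewrite eq_sym (negbTE ne).
  by rewrite big1 // => v vS; case: eqP => // e; rewrite e vS in fS.
rewrite exchange_big /= big_distrr /=.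
rewrite (eq_bigr (fun=> (#|S| * #|G|)%N)); last first.
  move=> u uS; rewrite exchange_big big_distrr /= -sum_nat_const.
  apply: eq_bigr => v vS; rewrite -(DN u v) ?(subsetP sSD) //; congr (_ * _)%N.
  rewrite /N -sum1dep_card big_mkcondr /=; apply: eq_bigr => g _.
  by case: eqP.
by rewrite sum_nat_const mulnA.
Qed.

Definition off_diagonal (S : {set T}) := [set p in setX S S | p.1 != p.2].

Lemma card_off_diagonal (S : {set T}) : #|off_diagonal S| = (#|S| * #|S|.-1)%N.
Proof.
pose diag := [set (x, x) | x in S].
have dE : #|diag| = #|S| by rewrite card_imset // => x y [].
have /setIidPr sd : diag \subset setX S S.
  by apply/subsetP=> _ /imsetP[x xS ->]; rewrite inE xS.
rewrite -subn1 mulnBr muln1 -cardsX -dE -sd -cardsD.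
apply: eq_card => -[x y]; rewrite !inE /= andbC; apply: andb_id2r => /andP[xS _].
by congr (~~ _); apply/eqP/imsetP => [<-|[z _ [-> ->]] //]; exists x.
Qed.

(* Averaging over [g], the size I of the intersection has mean m^2/n and I(I-1)
   has mean (m(m-1))^2/(n(n-1)); if I were never 1, then I <= I(I-1) always. *)
Lemma single_intersection G (S : {set T}) : 2 < #|T| -> two_transitive G ->
  0 < #|S| -> #|S|.-1 ^ 2 < #|T|.-1 ->
  exists2 g, g \in G & #|S :&: g @: S| = 1%N.
Proof.
move=> T3 tG S0 Ssmall.
case: (pickP (fun g => (g \in G) && (#|S :&: g @: S| == 1%N))) => [g /andP[gG /eqP]|none].
  by exists g.
pose I (g : {perm T}) := [set x in S | g x \in S].
have cI g : #|I g| = #|S :&: g @: S|.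
  rewrite -(card_imset _ (@perm_inj _ g)); congr #|pred_of_set _|.
  apply/setP=> y; apply/imsetP/setIP => [[x + ->]|[yS /imsetP[x xS e]]].
    by rewrite inE => /andP[xS gS]; split=> //; apply: imset_f.
  by exists x => //; rewrite inE xS -e.
have avg1 := @transitive_average T (fun g x => g x) G setT S (fun g h u => permM g h u)
  (fun g u _ => in_setT _) (fun u v _ _ => two_transitive_trans T3 tG u v) (subsetT S).
have : (#|off_diagonal setT| *
    \sum_(g in G) #|[set p in off_diagonal S | (g p.1, g p.2) \in off_diagonal S]|
    = #|off_diagonal S| ^ 2 * #|G|)%N.
  apply: (@transitive_average _ (fun g p => (g p.1, g p.2))).
- by move=> g h u; rewrite !permM.
- by move=> g u; rewrite !inE /= (inj_eq perm_inj).
- move=> [x y] [u v]; rewrite !inE /= => xy uv.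
  by have [g gG [<- <-]] := tG x y u v xy uv; exists g.
- by apply/subsetP=> -[x y]; rewrite !inE => /andP[].
rewrite !card_off_diagonal cardsT.
rewrite (eq_bigr (fun g => #|I g| * #|I g|.-1)%N); last first.
  move=> g gG; rewrite -card_off_diagonal; apply: eq_card => -[x y].
  rewrite !inE /= (inj_eq perm_inj) ; case: (x == y); rewrite ?andbF //= !andbT.
  by rewrite andbACA.
move: avg1; rewrite cardsT -/(I _) => avg1 avg2.
have : \sum_(g in G) #|I g| <= \sum_(g in G) #|I g| * #|I g|.-1.
  apply: leq_sum => g gG; have := none g; rewrite gG -cI /=.
  by case: #|I g| => [|[|k]] //= _; rewrite leq_pmulr.
move=> le.
have : #|S| ^ 2 * #|G| * #|T|.-1 <= #|S| ^ 2 * #|G| * #|S|.-1 ^ 2.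
  rewrite -{1}avg1 (mulnAC #|T|) -[X in _ <= X]mulnAC -expnMn -avg2.
  by rewrite leq_mul2l le orbT.
rewrite leq_pmul2l; last by rewrite muln_gt0 expn_gt0 S0 cardG_gt0.
by rewrite leqNgt Ssmall.
Qed.

Theorem two_transitive_jordan G s t : 2 < #|T| -> two_transitive G ->
  s \in G -> s != 1 -> #|moved s|.-1 ^ 2 < #|T|.-1 ->
  t \in G -> odd_perm t -> G :=: [set: {perm T}].
Proof.
move=> T3 tG sG s1 small tG' odd_t.
have m0 : 0 < #|moved s|.
  apply: contraR s1; rewrite -eqn0Ngt cards_eq0 => /eqP m0.
  apply/eqP/permP=> x; rewrite perm1; apply/eqP.
  by have := in_set0 x; rewrite -m0 inE => /negbT; rewrite negbK.
have [g gG /eqP/cards1P[a]] := single_intersection T3 tG m0 small.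
rewrite -movedJ => Ia; have := commg_moved Ia.
have : a \in moved s :&: moved (s ^ g) by rewrite Ia set11.
rewrite inE [a \in moved s]inE [a \in moved _]inE => /andP[sa ga] e.
apply: (two_transitive_full T3 tG _ _ _ _ tG' odd_t (a := a) (b := (s ^ g) a) (c := s a)).
- by rewrite eq_sym.
- by rewrite eq_sym.
- apply: contraNneq sa => e'; rewrite -in_set1 -Ia inE -{2}e' !moved_perm.
  by rewrite -in_setI Ia set11.
- by rewrite -e groupR ?groupJ.
Qed.

End MovedPoints.

(** * Transitivity from the absence of invariant sets *)

Section InvariantSets.

Local Open Scope group_scope.

Variable T : finType.
Implicit Types (s g h : {perm T}) (A B : {set T}) (G H : {group {perm T}}).

Definition has_invariant_set k s := [exists B : {set T}, (#|B| == k) && (s @: B == B)].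

Lemma has_invariant_setJ k s g : has_invariant_set k (s ^ g) = has_invariant_set k s.
Proof.
suff sub u h : has_invariant_set k u -> has_invariant_set k (u ^ h).
  by apply/idP/idP => [/(sub _ g^-1)|/sub]; rewrite ?conjgK.
case/existsP=> B /andP[/eqP Bk /eqP uB]; apply/existsP; exists (h @: B).
rewrite card_imset ?Bk ?eqxx /=; last exact: perm_inj.
apply/eqP; rewrite -{2}uB -!imset_comp; apply: eq_imset => x /=.
by rewrite permJ.
Qed.

(** If the orbit of [x] missed [u], the orbit and its complement in [A] would both be nonempty and
    invariant, and the smaller one has at most half the points of [A]. *)
Lemma transitive_on_invariant H A :
  (forall s, s \in H -> s @: A = A) ->
  (forall k, 0 < k -> k.*2 <= #|A| ->
     exists2 s, s \in H & forall B, B \subset A -> #|B| = k -> s @: B <> B) ->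
  forall x u, x \in A -> u \in A -> exists2 g, g \in H & g x = u.
Proof.
move=> HA noB x u xA uA; pose O := [set fun_of_perm g x | g in H].
have OA : O \subset A.
  by apply/subsetP=> _ /imsetP[g gH ->]; rewrite -(HA g gH) imset_f.
have HO s : s \in H -> s @: O = O.
  move=> sH; apply/eqP; rewrite eqEcard card_imset ?leqnn ?andbT; last exact: perm_inj.
  apply/subsetP=> _ /imsetP[_ /imsetP[g gH ->] ->].
  by rewrite -permM imset_f ?groupM.
have HAO s : s \in H -> s @: (A :\: O) = A :\: O.
  move=> sH; apply/eqP; rewrite eqEcard card_imset ?leqnn ?andbT; last exact: perm_inj.
  apply/subsetP=> _ /imsetP[y + ->]; rewrite !inE -{2}(HA s sH) -{2}(HO s sH).
  by rewrite !mem_imset //; exact: perm_inj.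
have xO : x \in O by apply/imsetP; exists 1; rewrite ?group1 ?perm1.
have [/imsetP[g gH ->]|uO] := boolP (u \in O); first by exists g.
have uAO : u \in A :\: O by rewrite inE uO.
have cA : #|O| + #|A :\: O| = #|A| by rewrite -(cardsID O A) (setIidPr OA).
case: (leqP #|O| #|A :\: O|) => le.
  have [||s sH /(_ O OA erefl) []] := noB #|O|; last exact: HO.
    by apply/card_gt0P; exists x.
  by rewrite -addnn -cA leq_add2l.
have [||s sH /(_ (A :\: O) (subsetDl _ _) erefl) []] := noB #|A :\: O|; last exact: HAO.
  by apply/card_gt0P; exists u.
by rewrite -addnn -cA leq_add2r ltnW.
Qed.

Lemma two_transitive_from_stabilizer G a :
  (forall x u, exists2 g, g \in G & g x = u) ->
  (forall y v, y != a -> v != a -> exists2 g, g \in G & g a = a /\ g y = v) ->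
  two_transitive G.
Proof.
move=> tr trA x y u v xy uv.
have [g gG gx] := tr x a; have [h hG hu] := tr u a.
have [|| k kG [ka ky]] := trA (g y) (h v).
- by rewrite -gx (inj_eq perm_inj) eq_sym.
- by rewrite -hu (inj_eq perm_inj) eq_sym.
exists (g * k * h^-1); first by rewrite !groupM ?groupV.
by rewrite !permM gx ka ky permK -hu permK.
Qed.

(** [transitive_on_invariant] is applied to [G] on all points, then to the stabilizer of [a] on the
    others. In the second case [t] excludes sizes up to [K]; larger sizes are excluded by elements
    with a fixed point, conjugated so that this point becomes [a]. *)
Lemma two_transitive_no_invariant_set G K s t a :
  s \in G -> (forall k, 0 < k -> k <= K -> ~~ has_invariant_set k s) ->
  t \in G -> t a = a ->
  (forall B, a \notin B -> 0 < #|B| -> #|B| <= K -> t @: B != B) ->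
  (forall k, K < k -> k.*2 <= #|T| ->
     exists2 g, g \in G & (exists b, g b = b) /\ ~~ has_invariant_set k g) ->
  two_transitive G.
Proof.
move=> sG s_no tG ta t_no G_no.
have noP k g B : ~~ has_invariant_set k g -> #|B| = k -> g @: B <> B.
  move=> /existsPn/(_ B) + Bk; rewrite Bk eqxx /= => + /eqP e.
  by rewrite e.
have tr x u : exists2 g, g \in G & g x = u.
  apply: (@transitive_on_invariant G setT) => // [g gG|k k0].
    by apply/eqP; rewrite eqEcard subsetT card_imset ?leqnn //; apply: perm_inj.
  rewrite cardsT => kT; have [kK|Kk] := leqP k K.
    by exists s => // B _; apply: noP; apply: s_no.
  by have [g gG [_ g_no]] := G_no k Kk kT; exists g => // B _; apply: noP.
apply: (two_transitive_from_stabilizer (a := a) tr) => y v ya va.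
pose H := 'C_G[a | 'P]%G.
have HP g : (g \in H) = (g \in G) && (g a == a).
  by rewrite inE; congr (_ && _); apply/astab1P/eqP.
have [||||g] := @transitive_on_invariant H (~: [set a]) _ _ y v.
- move=> g; rewrite HP => /andP[gG /eqP ga]; apply/eqP.
  rewrite eqEcard card_imset ?leqnn ?andbT; last exact: perm_inj.
  apply/subsetP=> _ /imsetP[z za ->]; move: za; rewrite !inE -{2}ga.
  by rewrite (inj_eq perm_inj).
- move=> k k0; rewrite cardsC1 => kT; have [kK|Kk] := leqP k K.
    exists t; first by rewrite HP tG ta eqxx.
    move=> B Ba Bk; apply/eqP/t_no; rewrite ?Bk //.
    by apply/negP=> /(subsetP Ba); rewrite !inE eqxx.
  have [|g gG [[b gb] g_no]] := G_no k Kk.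
    exact: leq_trans (leq_pred _).
  have [h hG ha] := tr b a; exists (g ^ h).
    by rewrite HP groupJ //= -ha permJ gb eqxx.
  by move=> B _; apply: noP; rewrite has_invariant_setJ.
- by rewrite !inE.
- by rewrite !inE.
- by rewrite HP => /andP[gG /eqP ga] gy; exists g.
Qed.

End InvariantSets.

(** * Cycles of a permutation and its restrictions to invariant sets *)

Section CycleDecomposition.

Local Open Scope group_scope.

Variable T : finType.
Implicit Types (s u v : {perm T}) (A B C : {set T}) (x y : T).

Lemma porbit_subset s B x : s @: B = B -> x \in B -> porbit s x \subset B.
Proof.
move=> sB xB; apply/subsetP=> y /porbitP[i ->]; rewrite permX.
by elim: i => //= i IH; rewrite -sB imset_f.
Qed.

Lemma imset_porbit s x : s @: porbit s x = porbit s x.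
Proof.
apply/eqP; rewrite eqEcard card_imset ?leqnn ?andbT; last exact: perm_inj.
apply/subsetP=> _ /imsetP[_ /porbitP[i ->] ->].
by rewrite -permM -expgSr mem_porbit.
Qed.

Lemma eq_in_porbit s u B x :
  s @: B = B -> {in B, s =1 u} -> x \in B -> porbit s x = porbit u x.
Proof.
move=> sB su xB.
have it i : (s ^+ i) x = (u ^+ i) x /\ (s ^+ i) x \in B.
  rewrite !permX; elim: i => //= i [<- IH]; split; first exact: su.
  by rewrite -sB imset_f.
by apply/setP=> y; apply/porbitP/porbitP=> -[i ->]; exists i; case: (it i).
Qed.

Lemma perm_onM_inl u v B C x : [disjoint B & C] ->
  perm_on B u -> perm_on C v -> x \in B -> (u * v) x = u x.
Proof.
move=> dBC uB vC xB; rewrite permM (out_perm vC) //.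
by rewrite (disjointFr dBC) // perm_closed.
Qed.

Lemma perm_onM_inr u v B C x : [disjoint B & C] ->
  perm_on B u -> perm_on C v -> x \in C -> (u * v) x = v x.
Proof.
by move=> dBC uB vC xC; rewrite permM (out_perm uB) // (disjointFl dBC).
Qed.

Lemma imset_perm_onM u v B C : [disjoint B & C] ->
  perm_on B u -> perm_on C v -> (u * v) @: B = B.
Proof.
move=> dBC uB vC; rewrite -[RHS](im_perm_on uB).
by apply: eq_in_imset => x; apply: perm_onM_inl dBC uB vC.
Qed.

Lemma imset_perm_onMr u v B C : [disjoint B & C] ->
  perm_on B u -> perm_on C v -> (u * v) @: C = C.
Proof.
move=> dBC uB vC; rewrite -[RHS](im_perm_on vC).
by apply: eq_in_imset => x; apply: perm_onM_inr dBC uB vC.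
Qed.

(** A permutation of [A] preserving [B] is in a unique way a product of a permutation of [B] and one
    of [A :\: B], namely of its two restrictions. *)
Lemma big_split_invariant (R : Type) (idx : R) (op : Monoid.com_law idx)
    A B (f : {perm T} -> R) : B \subset A ->
  \big[op/idx]_(s | perm_on A s && (s @: B == B)) f s =
  \big[op/idx]_(u | perm_on B u) \big[op/idx]_(v | perm_on (A :\: B) v) f (u * v).
Proof.
move=> sBA; pose C := A :\: B.
have dBC : [disjoint B & C] by apply/pred0P => x /=; rewrite !inE; case: (x \in B).
have invN s (D : {set T}) : s @: D = D -> s \in 'N(D | 'P).
  by move=> sD; apply/astabsP => x /=; rewrite /aperm -{1}sD mem_imset //; apply: perm_inj.
have invC s : perm_on A s -> s @: B = B -> s @: C = C.
  move=> sA sB; apply/eqP; rewrite eqEcard card_imset ?leqnn ?andbT; last exact: perm_inj.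
  apply/subsetP=> _ /imsetP[y + ->]; rewrite /C !inE (perm_closed _ sA) -{2}sB.
  by rewrite mem_imset //; exact: perm_inj.
rewrite (reindex_onto (fun p : {perm T} * {perm T} => p.1 * p.2)
  (fun s => (restr_perm B s, restr_perm C s))) /=; last first.
  move=> s /andP[sA /eqP sB]; apply/permP=> x; rewrite permM.
  have [xB|xB] := boolP (x \in B).
    rewrite (restr_permE (invN _ _ sB) xB) (out_perm (restr_perm_on _ _)) //.
    by rewrite (disjointFr dBC) // -sB imset_f.
  rewrite (out_perm (restr_perm_on B s)) //.
  have [xC|xC] := boolP (x \in C); first by rewrite restr_permE ?invN // invC.
  rewrite (out_perm (restr_perm_on _ _)) // (out_perm sA) //.
  by apply: contraNN xC => xA; rewrite inE xB.
rewrite pair_big /=; apply: eq_bigl => -[u v] /=.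
apply/idP/idP => [/andP[_ /eqP[<- <-]]|/andP[uB vC]]; first by rewrite !restr_perm_on.
have uvB := imset_perm_onM dBC uB vC; have uvC := imset_perm_onMr dBC uB vC.
rewrite uvB eqxx andbT; apply/andP; split.
  apply: perm_onM; first exact: subset_trans uB sBA.
  exact: subset_trans vC (subsetDl _ _).
apply/eqP; congr pair; apply/permP=> x.
  have [xB|xB] := boolP (x \in B).
    by rewrite restr_permE ?invN // (perm_onM_inl dBC uB vC).
  by rewrite (out_perm (restr_perm_on _ _)) // (out_perm uB).
have [xC|xC] := boolP (x \in C).
  by rewrite restr_permE ?invN // (perm_onM_inr dBC uB vC).
by rewrite (out_perm (restr_perm_on _ _)) // (out_perm vC).
Qed.

Definition cycles_in s A : {set {set T}} := porbit s @: A.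

Lemma cycles_in_eq s u A : s @: A = A -> {in A, s =1 u} -> cycles_in s A = cycles_in u A.
Proof. by move=> sA su; apply: eq_in_imset => x; apply: eq_in_porbit. Qed.

(** Separates the invariance of [B] from a condition that depends only on the restriction of [s] to
    [B]. *)
Lemma mem_cycles_in s A B : s @: A = A -> B \subset A ->
  (B \in cycles_in s A) = (s @: B == B) && (B \in cycles_in s B).
Proof.
move=> sA sBA; apply/imsetP/andP => [[x xA ->]|[/eqP sB /imsetP[x xB e]]].
  by rewrite imset_porbit eqxx; split=> //; apply: imset_f; apply: porbit_id.
by exists x => //; apply: (subsetP sBA).
Qed.

Lemma cycles_in_subset s A B : s @: A = A -> B \in cycles_in s A -> B \subset A.
Proof. by move=> sA /imsetP[x xA ->]; apply: porbit_subset. Qed.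

Lemma cycles_in_neq0 s A B : B \in cycles_in s A -> 0 < #|B|.
Proof. by case/imsetP=> x _ ->; apply/card_gt0P; exists x; apply: porbit_id. Qed.

Lemma partition_cycles_in s A : s @: A = A -> partition (cycles_in s A) A.
Proof.
move=> sA; have -> : cycles_in s A = equivalence_partition (fun x y => y \in porbit s x) A.
  apply/setP=> B; apply/imsetP/imsetP=> -[x xA ->]; exists x => //.
    apply/setP=> y; rewrite inE andb_idl // => yx.
    by apply: (subsetP (porbit_subset sA xA)).
  apply/setP=> y; rewrite inE andb_idl // => yx.
  by apply: (subsetP (porbit_subset sA xA)).
apply: equivalence_partitionP => x y z xA yA zA /=; rewrite porbit_id; split=> // xy.
by move: xy; rewrite -eq_porbit_mem => /eqP ->.
Qed.

Lemma cycles_in_remove s A B : s @: A = A -> B \in cycles_in s A ->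
  cycles_in s A :\ B = cycles_in s (A :\: B).
Proof.
move=> sA /imsetP[b bA ->]; apply/setP=> C; rewrite in_setD1.
apply/andP/imsetP=> [[CB /imsetP[x xA Cx]]|[x + ->]].
  exists x => //; rewrite inE xA andbT; move: CB.
  by rewrite Cx eq_porbit_mem.
rewrite inE => /andP[xB xA]; rewrite eq_porbit_mem; split=> //.
exact: imset_f.
Qed.

End CycleDecomposition.

Import Order.TTheory GRing.Theory Num.Theory.
Local Open Scope ring_scope.

(** * Multiplicative cycle weights and the number of cyclic permutations *)

Section CycleWeights.

Variables (R : realFieldType) (T : finType).
Implicit Types (w : nat -> R) (s u v : {perm T}) (A B C : {set T}).

Definition cycle_weight w A s : R := \prod_(B in cycles_in s A) w #|B|.

Definition total_weight w A : R := \sum_(s | perm_on A s) cycle_weight w A s.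

Lemma eq_cycle_weight w A s u : s @: A = A -> {in A, s =1 u} ->
  cycle_weight w A s = cycle_weight w A u.
Proof. by move=> sA su; rewrite /cycle_weight (cycles_in_eq sA su). Qed.

Lemma cycle_weight1 A s : cycle_weight (fun=> 1) A s = 1.
Proof. by rewrite /cycle_weight big1. Qed.

Lemma cycle_weight_removed w A B s : s @: A = A -> B \in cycles_in s A ->
  cycle_weight w A s = w #|B| * cycle_weight w (A :\: B) s.
Proof.
move=> sA BA; rewrite /cycle_weight (big_setD1 _ BA) /=.
by rewrite (cycles_in_remove sA BA).
Qed.

Lemma disjoint_setDl A B : [disjoint B & A :\: B].
Proof. by apply/pred0P => x /=; rewrite !inE; case: (x \in B). Qed.

Lemma cycle_weight_split w A B s : s @: A = A -> s @: B = B -> B \subset A ->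
  cycle_weight w A s = cycle_weight w B s * cycle_weight w (A :\: B) s.
Proof.
move=> sA sB BA; rewrite /cycle_weight -bigU /=; last first.
  apply/pred0P => C /=; apply/negP=> /andP[CB /imsetP[x + eC]].
  rewrite inE => /andP[/negP xB _]; apply: xB.
  by apply: (subsetP (cycles_in_subset sB CB)); rewrite eC porbit_id.
have {1}<- : B :|: A :\: B = A.
  by apply/setP=> x; rewrite !inE; have := subsetP BA x; case: (x \in B) => // ->.
by apply: eq_bigl => C; rewrite !inE /cycles_in imsetU inE.
Qed.

Lemma cycle_weightM w A B u v : B \subset A -> perm_on B u -> perm_on (A :\: B) v ->
  cycle_weight w A (u * v)%g = cycle_weight w B u * cycle_weight w (A :\: B) v.
Proof.
move=> BA uB vC; have dBC := disjoint_setDl A B.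
have uvB := imset_perm_onM dBC uB vC; have uvC := imset_perm_onMr dBC uB vC.
rewrite (cycle_weight_split _ (B := B)) //; last first.
  apply: im_perm_on; apply: perm_onM; first exact: subset_trans uB BA.
  exact: subset_trans vC (subsetDl _ _).
congr (_ * _); apply: eq_cycle_weight => // x xB.
  exact: perm_onM_inl dBC uB vC xB.
exact: perm_onM_inr dBC uB vC xB.
Qed.

(** After exchanging the sums, [s] preserves [B] and splits by [big_split_invariant]; the value 0
    discards the pairs that violate [P]. *)
Lemma sum_perm_on_subsets A (P : {perm T} -> pred {set T}) (f : {perm T} -> {set T} -> R) :
  (forall s B, perm_on A s -> P s B -> B \subset A /\ s @: B = B) ->
  \sum_(s | perm_on A s) \sum_(B | P s B) f s B =
  \sum_(B : {set T} | B \subset A) \sum_(u | perm_on B u) \sum_(v | perm_on (A :\: B) v)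
     (if P (u * v)%g B then f (u * v)%g B else 0).
Proof.
move=> PA; rewrite (exchange_big_dep (fun B => B \subset A)) /=; last first.
  by move=> s B sA /(PA s B sA)[].
apply: eq_bigr => B BA.
rewrite -(big_split_invariant _ (fun s => if P s B then f s B else 0)) //.
rewrite -big_mkcondr; apply: eq_bigl => s /=.
case: (boolP (perm_on A s)) => //= sA; apply/idP/andP => [sB|[]//].
by have [_ ->] := PA s B sA sB.
Qed.

Definition cyclic_count B := #|[set u | perm_on B u && (B \in cycles_in u B)]|.

(** Whether [B] is a cycle of [u * v] depends only on [u], while [g] sees only [v], so the double
    sum factors. *)
Lemma sum_cycles (phi : nat -> R) (g : {set T} -> {perm T} -> R) A :
  (forall B u v, B \subset A -> perm_on B u -> perm_on (A :\: B) v ->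
     g B (u * v)%g = g B v) ->
  \sum_(s | perm_on A s) \sum_(B in cycles_in s A) phi #|B| * g B s =
  \sum_(B : {set T} | B \subset A)
     phi #|B| * (cyclic_count B)%:R * \sum_(v | perm_on (A :\: B) v) g B v.
Proof.
move=> gM; rewrite sum_perm_on_subsets; last first.
  move=> s B sA BA; have sA' := im_perm_on sA.
  split; first exact: cycles_in_subset BA.
  by case/imsetP: BA => x _ ->; apply: imset_porbit.
apply: eq_bigr => B BA; have dBC := disjoint_setDl A B.
transitivity (\sum_(u | perm_on B u && (B \in cycles_in u B))
   \sum_(v | perm_on (A :\: B) v) phi #|B| * g B v).
  rewrite big_mkcondr; apply: eq_bigr => u uB.
  rewrite -[RHS]mulr1n -[if _ then _ else _]mulr1n.
  case: ifPn => uBB; [|rewrite mul0rn big1 //]; last first.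
    move=> v vC; rewrite mem_cycles_in //; last first.
      apply: im_perm_on; apply: perm_onM; first exact: subset_trans uB BA.
      exact: subset_trans vC (subsetDl _ _).
    rewrite (cycles_in_eq (u := u)) ?(negbTE uBB) ?andbF //.
      exact: imset_perm_onM dBC uB vC.
    by move=> x; apply: perm_onM_inl dBC uB vC.
  rewrite mulr1n; apply: eq_bigr => v vC; rewrite gM //.
  rewrite mem_cycles_in //; last first.
    apply: im_perm_on; apply: perm_onM; first exact: subset_trans uB BA.
    exact: subset_trans vC (subsetDl _ _).
  rewrite (cycles_in_eq (u := u)) ?uBB ?andbT.
  - by rewrite (imset_perm_onM dBC uB vC) eqxx.
  - exact: imset_perm_onM dBC uB vC.
  - by move=> x; apply: perm_onM_inl dBC uB vC.
rewrite sumr_const -big_distrr /= -mulrnAl -[_ *+ _]mulr_natr; congr (_ * _%:R * _).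
by apply: eq_card => u; rewrite !inE.
Qed.

Lemma sum_cycle_lengths A s : perm_on A s -> \sum_(B in cycles_in s A) #|B|%:R = #|A|%:R :> R.
Proof.
move=> /im_perm_on/partition_cycles_in/card_partition ->.
by rewrite natr_sum.
Qed.

Lemma sum_subsets_card A (f : nat -> R) :
  \sum_(B : {set T} | B \subset A) f #|B| = \sum_(j < #|A|.+1) 'C(#|A|, j)%:R * f j.
Proof.
rewrite (partition_big (fun B => inord #|B| : 'I_(#|A|.+1)) predT) //=.
apply: eq_bigr => j _; rewrite -cards_draws -sum1dep_card natr_sum mulr_suml.
have inE' B : B \subset A -> (inord #|B| == j :> 'I__) = (#|B| == j).
  by move=> BA; rewrite -val_eqE /= inordK // ltnS subset_leq_card.
apply: eq_big => B; last by move=> /andP[BA]; rewrite inE' // => /eqP ->; rewrite mul1r.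
by case: (boolP (B \subset A)) => //= BA; rewrite inE'.
Qed.

(* Specialising the double count of pairs (permutation, cycle) to constant
   weights determines the number of cyclic permutations inductively. *)
Lemma cyclic_countE B : (0 < #|B|)%N -> cyclic_count B = (#|B|.-1)`!.
Proof.
have [m] := ubnP #|B|; elim: m B => // m IH A /ltnSE Am A0.
have := sum_cycles (fun j => j%:R) (g := fun _ _ => 1) (A := A) (fun _ _ _ _ _ _ => erefl).
under eq_bigr => s sA do under eq_bigr do rewrite mulr1.
under eq_bigr => s sA do rewrite sum_cycle_lengths //.
rewrite sumr_const card_perm.
pose n := #|A|; pose f j : R :=
  if j == n then (n * cyclic_count A)%:R else if j == 0 then 0 else (j`! * (n - j)`!)%:R.
rewrite (eq_bigr (fun B => f #|B|)); last first.
  move=> B BA; rewrite sumr_const card_perm cardsD (setIidPr BA) /f -/n.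
  have [eBA|nBA] := eqVneq #|B| n.
    have -> : B = A by apply/eqP; rewrite eqEcard BA eBA leqnn.
    by rewrite subnn mulr1 natrM.
  have [->|B0] := eqVneq #|B| 0; first by rewrite !mul0r.
  rewrite -lt0n in B0; rewrite IH //; last first.
    by apply: leq_trans Am; rewrite ltn_neqAle nBA subset_leq_card.
  have -> : #|B|`! = (#|B| * (#|B|.-1)`!)%N by rewrite -{1 2}(prednK B0) -factS.
  by rewrite -!natrM.
have [p np] : exists p, n = p.+1 by exists n.-1; rewrite prednK.
rewrite sum_subsets_card -/n np big_ord_recr big_ord_recl /=.
have -> : f 0 = 0 by rewrite /f np.
have -> : f p.+1 = (p.+1 * cyclic_count A)%:R by rewrite /f np eqxx.
(* With n = p + 1, each of the [p] sizes strictly between 0 and n contributes n!. The total is n *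
   n!, so n * [cyclic_count A] = n! remains. *)
rewrite (eq_bigr (fun=> (p.+1)`!%:R)); last first.
  move=> i _; have ip := ltn_ord i.
  rewrite /f np /bump /= add1n eqSS (ltn_eqF ip) -natrM bin_fact //; exact: ltnW.
rewrite mulr0 add0r binn mul1r sumr_const card_ord => /eqP.
rewrite -!mulrnA -natrD eqr_nat !factS -/n => /eqP e.
apply/eqP; rewrite -(eqn_pmul2l (ltn0Sn p)).
by apply/eqP; move: e; set x := (p.+1 * p`!)%N; set y := (p.+1 * cyclic_count A)%N; lia.
Qed.

End CycleWeights.

(** * The exponential formula *)

Section WeightCoefficients.

Variable R : realFieldType.
Implicit Types (w : nat -> R).

(* The coefficients of [exp (\sum_j w j * x ^ j / j)], by the recursion obtained
   on differentiating. *)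
Fixpoint exp_coefs w n : seq R :=
  if n is m.+1 then
    rcons (exp_coefs w m)
      ((\sum_(i < m.+1) w (m.+1 - i)%N * (exp_coefs w m)`_i) / m.+1%:R)
  else [:: 1].

Definition exp_coef w n : R := (exp_coefs w n)`_n.

Lemma size_exp_coefs w n : size (exp_coefs w n) = n.+1.
Proof. by elim: n => //= n IH; rewrite size_rcons IH. Qed.

Lemma nth_exp_coefs w n i : (i <= n)%N -> (exp_coefs w n)`_i = exp_coef w i.
Proof.
elim: n i => [|n IH] i; first by case: i.
rewrite leq_eqVlt => /predU1P[->//|]; rewrite ltnS => le.
by rewrite /= nth_rcons size_exp_coefs ltnS le IH.
Qed.

Lemma exp_coef0 w : exp_coef w 0 = 1. Proof. by []. Qed.

Lemma exp_coefS w n :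
  n.+1%:R * exp_coef w n.+1 = \sum_(i < n.+1) w (n.+1 - i)%N * exp_coef w i.
Proof.
rewrite /exp_coef /= nth_rcons size_exp_coefs ltnn eqxx.
rewrite [LHS]mulrC divfK ?pnatr_eq0 //.
by apply: eq_bigr => i _; rewrite nth_exp_coefs // -ltnS.
Qed.

Lemma exp_coef_ge0 w n : (forall j, (0 < j)%N -> 0 <= w j) -> 0 <= exp_coef w n.
Proof.
move=> w0; have [m] := ubnP n; elim: m n => // m IH [//|n] /ltnSE nm.
rewrite -(@pmulr_rge0 _ n.+1%:R) ?ltr0n // exp_coefS; apply: sumr_ge0 => i _.
rewrite mulr_ge0 ?w0 ?subn_gt0 // IH //.
exact: leq_trans (ltn_ord i) nm.
Qed.

(** The series is exp (- log (1 - x)) = 1 / (1 - x). *)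
Lemma exp_coef1 n : exp_coef (fun=> 1) n = 1.
Proof.
have [m] := ubnP n; elim: m n => // m IH [//|n] /ltnSE nm.
apply: (@mulfI _ n.+1%:R); rewrite ?pnatr_eq0 // exp_coefS mulr1.
rewrite (eq_bigr (fun=> 1)) ?sumr_const ?card_ord // => i _.
by rewrite IH ?mulr1 //; exact: leq_trans (ltn_ord i) nm.
Qed.

Section OverFinType.

Variable T : finType.
Implicit Types (s u v : {perm T}) (A B C : {set T}).

(** The formula for proper complements is a hypothesis so that the lemma can serve in the induction
    of [total_weightE]. A cycle of length j among n points can be chosen in C(n, j) (j - 1)! ways,
    and C(n, j) (j - 1)! (n - j)! = n! / j. *)
Lemma sum_cycle_removed_aux w (phi : nat -> R) A :
  (forall B, B \subset A -> (0 < #|B|)%N ->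
     total_weight w (A :\: B) = (#|A| - #|B|)`!%:R * exp_coef w (#|A| - #|B|)) ->
  \sum_(s | perm_on A s) \sum_(B in cycles_in s A)
     phi #|B| * cycle_weight w (A :\: B) s =
  #|A|`!%:R * \sum_(i < #|A|) phi (#|A| - i)%N / (#|A| - i)%:R * exp_coef w i.
Proof.
move=> tw; rewrite sum_cycles; last first.
  move=> B u v BA uB vC; have dBC := disjoint_setDl A B.
  apply: eq_cycle_weight; first exact: imset_perm_onMr dBC uB vC.
  by move=> x; apply: perm_onM_inr dBC uB vC.
pose f j := if j is i.+1 then
  phi j * (i`! * (#|A| - j)`!)%:R * exp_coef w (#|A| - j) else 0.
rewrite (eq_bigr (fun B => f #|B|)); last first.
  move=> B BA; case: (posnP #|B|) => [B0|B0].
    rewrite /f B0 (_ : cyclic_count B = 0) ?mulr0 ?mul0r //.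
    apply: eq_card0 => u; rewrite !inE; apply/negbTE/nandP; right.
    by apply/negP=> /cycles_in_neq0; rewrite B0.
  rewrite -/(total_weight _ _) tw // cyclic_countE // /f.
  by case: #|B| B0 => [//|k] _ /=; rewrite ?natrM ?mulrA.
rewrite sum_subsets_card big_ord_recl mulr0 add0r [X in _ * X](reindex_inj rev_ord_inj) /=.
rewrite big_distrr /=; apply: eq_bigr => i _; have iA := ltn_ord i.
have -> : bump 0 i = i.+1 by []; rewrite add0n.
rewrite (subKn iA) -(bin_fact iA) factS !natrM.
have i0 : i.+1%:R != 0 :> R by rewrite pnatr_eq0.
by move: (i.+1%:R : R) i0 => c c0; field.
Qed.

(** The cycle lengths of a permutation add up to |A|, so |A| times the total weight is a sum over
    permutations with a marked cycle. Removing that cycle gives the recursion [exp_coefS]. *)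
Lemma total_weightE w A : total_weight w A = #|A|`!%:R * exp_coef w #|A|.
Proof.
have [m] := ubnP #|A|; elim: m A => // m IH A /ltnSE Am.
case E : #|A| => [|n].
  move/eqP: E; rewrite cards_eq0 => /eqP ->; rewrite exp_coef0 mulr1 /total_weight.
  rewrite (eq_bigl (pred1 (1%g : {perm T}))) ?big_pred1_eq; last first.
    move=> s /=; apply/idP/eqP => [s0|->]; last exact: perm_on1.
    by apply: (perm_on_id s0); rewrite cards0.
  by rewrite /cycle_weight /cycles_in imset0 big_set0.
have n0 : #|A|%:R != 0 :> R by rewrite E pnatr_eq0.
apply: (mulfI n0); rewrite -E [RHS]mulrCA E exp_coefS -E.
have := @sum_cycle_removed_aux w (fun j => j%:R * w j) A.
rewrite (eq_bigr (fun s => #|A|%:R * cycle_weight w A s)); last first.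
  move=> s sA; rewrite -(sum_cycle_lengths _ sA) mulr_suml; apply: eq_bigr => B BA.
  rewrite (cycle_weight_removed _ _ BA) ?mulrA //; exact: im_perm_on.
rewrite -big_distrr -/(total_weight _ _) => ->.
  congr (_ * _); apply: eq_bigr => i _.
  by rewrite [_ * w _ / _]mulrAC divff ?mul1r // pnatr_eq0 subn_eq0 -ltnNge.
move=> B BA B0; rewrite IH cardsD (setIidPr BA) //.
by apply: leq_trans Am; rewrite ltn_subrL B0 E.
Qed.

Lemma sum_cycle_removed w (phi : nat -> R) A :
  \sum_(s | perm_on A s) \sum_(B in cycles_in s A)
     phi #|B| * cycle_weight w (A :\: B) s =
  #|A|`!%:R * \sum_(i < #|A|) phi (#|A| - i)%N / (#|A| - i)%:R * exp_coef w i.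
Proof.
apply: sum_cycle_removed_aux => B BA _.
by rewrite total_weightE cardsD (setIidPr BA).
Qed.

(** A permutation with a marked invariant k-set is a pair of permutations, of the set and of its
    complement, and the weights multiply. *)
Lemma sum_invariant_sets w A k : (k <= #|A|)%N ->
  \sum_(s | perm_on A s)
    \sum_(B : {set T} | [&& B \subset A, s @: B == B & #|B| == k]) cycle_weight w A s =
  #|A|`!%:R * (exp_coef w k * exp_coef w (#|A| - k)).
Proof.
move=> kA; rewrite sum_perm_on_subsets; last by move=> s B sA /and3P[BA /eqP].
pose f j : R := if j == k then
  k`!%:R * exp_coef w k * ((#|A| - k)`!%:R * exp_coef w (#|A| - k)) else 0.
rewrite (eq_bigr (fun B => f #|B|)); last first.
  move=> B BA; rewrite /f; have [Bk|Bk] := eqVneq #|B| k; last first.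
    by rewrite big1 // => u _; rewrite big1 // => v _; rewrite !andbF.
  rewrite -Bk -(setIidPr BA) -cardsD (setIidPr BA) -!total_weightE /total_weight.
  rewrite mulr_suml; apply: eq_bigr => u uB; rewrite mulr_sumr; apply: eq_bigr => v vC.
  rewrite BA (imset_perm_onM (disjoint_setDl A B) uB vC) eqxx /=.
  exact: cycle_weightM.
rewrite sum_subsets_card (bigD1 (inord k)) //= inordK ?ltnS //.
rewrite big1 ?addr0 => [|j]; last first.
  by rewrite -val_eqE /= inordK ?ltnS // /f => /negbTE ->; rewrite mulr0.
rewrite /f eqxx -(bin_fact kA) !natrM; ring.
Qed.

End OverFinType.

End WeightCoefficients.

(** * Bounds on the coefficients for particular weights *)

Section CoefficientEstimates.

Variable R : realFieldType.

(** The recursion reads n e_n = e_0 + ... + e_(n-K-1). For n <= 2K + 1 the term e_0 = 1 suffices.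
    For larger n there are also n - 2K - 1 terms of index above [K], each at least 1 / (2K + 1) by
    induction, and 1 + (n - 2K - 1) / (2K + 1) = n / (2K + 1). *)
Lemma exp_coef_long_ge K n : (K < n)%N ->
  1 / (2 * K + 1)%:R <= exp_coef (fun j => (K < j)%N%:R : R) n.
Proof.
set w := fun j => _; pose S m : R := \sum_(i < m) exp_coef w i.
have rec n' : n'.+1%:R * exp_coef w n'.+1 = S (n'.+1 - K)%N.
  rewrite exp_coefS /S (big_ord_widen n'.+1 (exp_coef w)) ?leq_subr //.
  rewrite [RHS]big_mkcond; apply: eq_bigr => i _ /=.
  rewrite /w; have -> : (K < n'.+1 - i)%N = (i < n'.+1 - K)%N by lia.
  by case: ifP; rewrite ?mul1r ?mul0r.
have SS m : S m.+1 = S m + exp_coef w m by rewrite /S big_ord_recr.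
have S1 m : (0 < m)%N -> 1 <= S m.
  case: m => // m _; rewrite /S big_ord_recl exp_coef0 lerDl sumr_ge0 // => i _.
  by apply: exp_coef_ge0 => j _; rewrite ler0n.
have [m] := ubnP n; elim: m n => // m IH [//|n] /ltnSE nm Kn.
have c0 : 0 < (2 * K + 1)%:R :> R by rewrite ltr0n addn1.
have n0 : 0 < n.+1%:R :> R by rewrite ltr0n.
have Sq q : (K + q <= n)%N -> 1 + q%:R / (2 * K + 1)%:R <= S (K.+1 + q)%N.
  elim: q => [|q IHq] le; first by rewrite mul0r addr0 S1 // addn0.
  rewrite (addnS K.+1 q) SS -(natr1 q) mulrDl addrA lerD //; last by apply: IH; lia.
  by apply: IHq; lia.
rewrite -(ler_pM2l n0) rec mulrA mulr1 ler_pdivrMr //.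
have [le|lt] := leqP n.+1 (2 * K + 1).
  rewrite -[X in X <= _]mul1r ler_pM ?ler_nat ?S1 ?ler01 ?ler0n //; lia.
rewrite -ler_pdivrMr // (_ : (n.+1 - K = K.+1 + (n.+1 - (2 * K + 1)))%N); last by lia.
apply: le_trans (Sq _ _); last by lia.
rewrite natrB; last by lia.
by rewrite mulrBl divff ?(gt_eqF c0) // addrCA subrr addr0.
Qed.

(* Markov's inequality for the weighted number of cycles: the [i]-th summand is
   the expected contribution of the cycles of length [n - i]. *)
Lemma exp_coef_markov (w : nat -> R) n :
  (forall j, (0 < j)%N -> 0 <= w j <= 1) ->
  1 - \sum_(i < n) (1 - w (n - i)%N) / (n - i)%:R <= exp_coef w n.
Proof.
move=> w01; pose A := [set: 'I_n].
have An : #|A| = n by rewrite cardsT card_ord.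
have n0 : 0 < n`!%:R :> R by rewrite ltr0n fact_gt0.
have := total_weightE w A; have := sum_cycle_removed (fun=> 1) (fun j => 1 - w j) A.
rewrite An; under [X in _ = _ * X]eq_bigr do rewrite exp_coef1 mulr1.
move=> sumE twE; rewrite -(ler_pM2l n0) -twE mulrBr mulr1 -sumE.
have -> : n`!%:R = \sum_(s : {perm 'I_n} | perm_on A s) 1 :> R.
  by rewrite sumr_const card_perm An.
rewrite -sumrB ler_sum // => s sA.
under eq_bigr do rewrite cycle_weight1 mulr1.
have w01' B : B \in cycles_in s A -> 0 <= w #|B| <= 1.
  by move=> /cycles_in_neq0; apply: w01.
(* Weierstrass's product inequality; the induction also carries the bounds on the product. *)
suff : 0 <= cycle_weight w A s <= 1 /\
    1 - \sum_(B in cycles_in s A) (1 - w #|B|) <= cycle_weight w A s by case.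
rewrite /cycle_weight; elim/big_rec2: _ => [|B p x BA []]; first by split; lra.
by have := w01' B BA; move: (w #|B|) => a a01 p01 le; split; nra.
Qed.

(** The resulting [cycle_weight] is [y] to the number of cycles of length at most [k]. *)
Definition short_weight (y : R) k j : R := if (j <= k)%N then y else 1.

Section ShortWeight.

Variables (y : R) (k : nat).
Local Notation e := (exp_coef (short_weight y k)).

Lemma exp_coef_short_ge0 n : 0 <= y -> 0 <= e n.
Proof. by move=> y0; apply: exp_coef_ge0 => j _; rewrite /short_weight; case: ifP. Qed.

Lemma exp_coef_short_sum n :
  n%:R * e n = y * (\sum_(i < n) e i) + (1 - y) * \sum_(i < n - k) e i.
Proof.
case: n => [|n]; first by rewrite !big_ord0 mul0r !mulr0 addr0.
rewrite exp_coefS [X in _ + _ * X](big_ord_widen n.+1 e) ?leq_subr //.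
rewrite [X in _ + _ * X]big_mkcond !mulr_sumr -big_split /=; apply: eq_bigr => i _.
rewrite /short_weight; have -> : (n.+1 - i <= k)%N = ~~ (i < n.+1 - k)%N.
  by have := ltn_ord i; lia.
by case: (i < _)%N => /=; ring.
Qed.

(** The difference of two consecutive instances of [exp_coef_short_sum]: both sums collapse to
    single terms. *)
Lemma exp_coef_short_step n :
  n.+1%:R * e n.+1 = (n%:R + y) * e n + (1 - y) * (if (k <= n)%N then e (n - k)%N else 0).
Proof.
rewrite exp_coef_short_sum big_ord_recr /= (mulrDl n%:R) exp_coef_short_sum.
have [kn|nk] := leqP k n; first by rewrite subSn // big_ord_recr /=; ring.
have -> : (n.+1 - k = 0)%N by lia.
have -> : (n - k = 0)%N by lia.
by rewrite big_ord0; ring.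
Qed.

End ShortWeight.

(** For m >= k, e_(m+1) is a weighted average of e_m and e_(m-k), so the bound propagates once it
    holds for indices from k to 2k + 1. There the increments add up to at most S_(k+1) / (2 (k +
    1)), and S_(k+1) = (2k + 1) e_k. *)
Lemma exp_coef_half_tail k n : (0 < k)%N -> (k <= n)%N ->
  exp_coef (short_weight (1 / 2) k) n <= 2 * exp_coef (short_weight (1 / 2) k) k.
Proof.
move=> k0; set e := exp_coef _; pose S m := \sum_(i < m) e i.
have e0 m : 0 <= e m by apply: exp_coef_short_ge0; lra.
have step m : (k <= m)%N -> m.+1%:R * e m.+1 = (m%:R + 1 / 2) * e m + 1 / 2 * e (m - k)%N.
  by move=> km; rewrite /e exp_coef_short_step km; congr (_ + _ * _); lra.
have SS m : S m.+1 = S m + e m by rewrite /S big_ord_recr.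
have Sk : S k.+1 = (2 * k%:R + 1) * e k.
  by have := exp_coef_short_sum (1 / 2) k k; rewrite subnn big_ord0 -/e SS -/(S k); lra.
have near i : (i <= k.+1)%N -> e (k + i)%N <= e k + S i / (2 * k.+1%:R).
  have c0 : 0 < k.+1%:R :> R by rewrite ltr0n.
  elim: i => [|i IH] ik; first by rewrite addn0 /S big_ord0 mul0r addr0.
  have {}IH := IH (ltnW ik).
  have := step _ (leq_addr i k); rewrite addnS SS addnC addnK => h.
  have : (i + k).+1%:R * e (i + k).+1 <= (i + k).+1%:R * (e (i + k)%N + e i / (2 * k.+1%:R)).
    rewrite h mulrDr -(natr1 (i + k)%N) mulrDl lerD //; first by have := e0 (i + k)%N; lra.
    rewrite natr1 mulrA ler_pdivlMr; last by lra.
    have : k.+1%:R <= (i + k).+1%:R :> R by rewrite ler_nat; lia.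
    move: (e i) (e0 i) => x x0; nra.
  rewrite ler_pM2l ?ltr0n // => h'; rewrite mulrDl addrA; apply: le_trans h' _.
  by rewrite lerD2r addnC.
have Smono i : (i <= k.+1)%N -> S i <= S k.+1.
  by move=> ik; rewrite /S (big_ord_widen k.+1 e ik) big_mkcond ler_sum // => j _; case: ifP.
have [m] := ubnP n; elim: m n => // m IH n /ltnSE nm kn.
have [n2k|n2k] := leqP n (k + k.+1).
  rewrite -(subnKC kn); apply: le_trans (near _ _) _; first by lia.
  have := Smono (n - k)%N; rewrite Sk => /(_ _) h.
  have {}h : S (n - k)%N <= (2 * k%:R + 1) * e k by apply: h; lia.
  have ck : 0 <= k%:R :> R by rewrite ler0n.
  have : S (n - k)%N / (2 * k.+1%:R) <= e k; last by move: (_ / _) => z ?; lra.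
  rewrite ler_pdivrMr; last by rewrite mulr_gt0 ?ltr0n.
  by apply: le_trans h _; rewrite -(natr1 k); have := e0 k; lra.
case: n nm kn n2k => // n nm kn n2k.
have n0 : 0 < n.+1%:R :> R by rewrite ltr0n.
rewrite -(ler_pM2l n0) step; last by lia.
have h1 : e (n - k)%N <= 2 * e k by apply: IH; lia.
have h2 : e n <= 2 * e k by apply: IH; lia.
have m0 : 0 <= n%:R :> R by rewrite ler0n.
by have := ler_wpM2l m0 h2; rewrite -(natr1 n); lra.
Qed.

(* The coefficients [e] increase, so n e_n - \sum_(i < n) e_i is at least
   k (e_n - e_k); by the recursion it is at most k e_n / 3. *)
Lemma exp_coef_third_tail k n : (0 < k)%N -> (k <= n)%N ->
  exp_coef (short_weight (4 / 3) k) n <= 3 / 2 * exp_coef (short_weight (4 / 3) k) k.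
Proof.
move=> k0 kn; set e := exp_coef _; pose S m := \sum_(i < m) e i.
have e0 m : 0 <= e m by apply: exp_coef_short_ge0; lra.
have step m : m.+1%:R * (e m.+1 - e m) = 1 / 3 * (e m - (if (k <= m)%N then e (m - k)%N else 0)).
  have := exp_coef_short_step (4 / 3) k m; rewrite -/e -(natr1 m).
  by case: ifP => _; lra.
have mono1 m : e m <= e m.+1.
  have [N] := ubnP m; elim: N m => // N IH m /ltnSE mN.
  rewrite -subr_ge0 -(@pmulr_rge0 _ m.+1%:R) ?ltr0n // step mulr_ge0 // ?subr_ge0; first by lra.
  case: ifP => // km.
  have : forall i, (i <= k)%N -> e (m - k)%N <= e (m - k + i)%N.
    elim=> [|i IHi] ik; first by rewrite addn0.
    by apply: le_trans (IHi _) _; rewrite ?addnS ?IH //; lia.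
  by move/(_ k (leqnn k)); rewrite subnK.
have mono i j : (i <= j)%N -> e i <= e j.
  by move/subnKC <-; elim: (j - i)%N => [|d IH]; rewrite ?addn0 ?addnS // (le_trans IH).
have sumE := exp_coef_short_sum (4 / 3) k n; rewrite -/e -/(S n) -/(S (n - k)%N) in sumE.
have short : S n - S (n - k)%N <= k%:R * e n.
  rewrite /S (big_ord_widen n e (leq_subr k n)) [X in _ - X]big_mkcond -sumrB.
  apply: (@le_trans _ _ (\sum_(i < n) if (i < n - k)%N then 0 else e n)).
    apply: ler_sum => i _; case: ifP => _; first by rewrite subrr.
    by rewrite subr0; apply: mono; apply: ltnW.
  rewrite (eq_bigr (fun i : 'I_n => (i >= n - k)%N%:R * e n)); last first.
    by move=> i _; case: ltnP => _; rewrite ?mul0r ?mul1r.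
  rewrite -mulr_suml ler_wpM2r // -natr_sum ler_nat.
  have -> m c : (\sum_(i < m) (c <= i) = m - c)%N.
    by elim: m => [|m IH]; rewrite ?big_ord0 ?big_ord_recr /= ?IH; lia.
  by rewrite subKn.
have low : k%:R * (e n - e k) <= n%:R * e n - S n.
  have -> : n%:R * e n - S n = \sum_(i < n) (e n - e i).
    by rewrite sumrB sumr_const card_ord mulr_natl.
  have -> : k%:R * (e n - e k) = \sum_(i < n) if (i < k)%N then e n - e k else 0.
    rewrite -big_mkcond /= -(big_ord_widen n (fun=> e n - e k) kn).
    by rewrite sumr_const card_ord mulr_natl.
  apply: ler_sum => i _; case: ifP => ik; last by rewrite subr_ge0 mono // ltnW.
  by rewrite lerB // mono // ltnW.
have ck : 0 < k%:R :> R by rewrite ltr0n.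
rewrite -(ler_pM2l ck); move: sumE short low (e0 n) (e0 k).
by move: (S n) (S _) => a b; lra.
Qed.

(** Below [k] the recurrence is e_(n+1) = (n + 4/3) / (n + 1) * e_n, so e_n grows like n^(1/3);
    cubing avoids roots. *)
Lemma exp_coef_third_cube k n : (n <= k)%N ->
  exp_coef (short_weight (4 / 3) k) n ^+ 3 <= 3 * n%:R + 1.
Proof.
set e := exp_coef _; elim: n => [|n IH] nk; first by rewrite /e exp_coef0; lra.
have n0 : 0 < n.+1%:R :> R by rewrite ltr0n.
have := exp_coef_short_step (4 / 3) k n; rewrite leqNgt nk /= mulr0 addr0 -/e => step.
have {}IH := IH (ltnW nk).
rewrite -(ler_pM2l (exprn_gt0 3 n0)) -exprMn step exprMn.
move: IH; have : 0 <= e n ^+ 3 by rewrite exprn_ge0 //; apply: exp_coef_short_ge0; lra.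
have m0 : 0 <= n%:R :> R by rewrite ler0n.
rewrite -(natr1 n); move: (n%:R : R) (e n ^+ 3) m0 => m x m0 x0 IH.
have : (m + 4 / 3) ^+ 3 * x <= (m + 4 / 3) ^+ 3 * (3 * m + 1).
  by rewrite ler_pM2l // exprn_gt0 //; lra.
move=> h; apply: le_trans h _; nra.
Qed.

(** Below [k] the recurrence is e_(n+1) = (n + 1/2) / (n + 1) * e_n, so e_n decays like n^(-1/2). *)
Lemma exp_coef_half_sqr k n : (n <= k)%N ->
  exp_coef (short_weight (1 / 2) k) n ^+ 2 <= 1 / n.+1%:R.
Proof.
set e := exp_coef _; elim: n => [|n IH] nk; first by rewrite /e exp_coef0; lra.
have n0 : 0 < n.+1%:R :> R by rewrite ltr0n.
have := exp_coef_short_step (1 / 2) k n; rewrite leqNgt nk /= mulr0 addr0 -/e => step.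
have := IH (ltnW nk); rewrite !ler_pdivlMr ?ltr0n // => {}IH.
rewrite -(ler_pM2l (exprn_gt0 2 n0)) mulrA -exprMn step exprMn.
move: (e n ^+ 2) (sqr_ge0 (e n)) IH n0; rewrite -(natr1 n.+1) -(natr1 n) => x x0 IH n0.
have m0 : 0 <= n%:R :> R by rewrite ler0n.
move: (n%:R : R) m0 IH n0 => m m0 IH n0.
have : (m + 1 / 2) ^+ 2 * (m + 1 + 1) * (x * (m + 1)) <= (m + 1)^+3 * 1.
  apply: ler_pM => //; [nra|nra|nra].
by move=> h; rewrite -(ler_pM2l n0); lra.
Qed.

End CoefficientEstimates.

(** * Counting permutations by cycle type *)

Section CycleTypeCounts.

Variables (R : realFieldType) (T : finType).
Implicit Types (s : {perm T}) (B C : {set T}).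

Local Notation n := #|T|.

Lemma perm_onT s : perm_on [set: T] s.
Proof. exact/subsetP. Qed.

Lemma imset_permT s : s @: [set: T] = [set: T].
Proof. exact: im_perm_on (perm_onT s). Qed.

Lemma sum_perm_onT (f : {perm T} -> R) : \sum_(s | perm_on [set: T] s) f s = \sum_s f s.
Proof. by apply: eq_bigl => s; rewrite perm_onT. Qed.

Lemma card_pred_sum (E : pred {perm T}) : #|E|%:R = \sum_s (E s)%:R :> R.
Proof.
rewrite -sum1_card natr_sum big_mkcond; apply: eq_bigr => s _.
by rewrite unfold_in; case: (E s).
Qed.

Lemma cycle_weight_pred (w : pred nat) (A : {set T}) s :
  cycle_weight (fun j => (w j)%:R : R) A s = [forall B in cycles_in s A, w #|B|]%:R.
Proof.
rewrite /cycle_weight; case: (boolP [forall B in _, _]) => [/forall_inP wB|].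
  by rewrite big1 => [|B /wB -> //]; rewrite mulr1n.
rewrite negb_forall_in => /exists_inP[B BA wB].
by rewrite (bigD1 B) //= (negbTE wB) mul0r.
Qed.

Definition special_cycle (p w : pred nat) s :=
  [exists B in cycles_in s [set: T], p #|B| && [forall C in cycles_in s (~: B), w #|C|]].

(** Since [p] and [w] exclude each other, a permutation has at most one special cycle, so
    [sum_cycle_removed] counts it at most once. *)
Lemma card_special_cycle (p w : pred nat) : (forall j, p j -> ~~ w j) ->
  n`!%:R * \sum_(i < n) (p (n - i)%N)%:R / (n - i)%:R * exp_coef (fun j => (w j)%:R : R) i
    <= #|special_cycle p w|%:R.
Proof.
move=> pw; rewrite card_pred_sum.
have := sum_cycle_removed (fun j => (w j)%:R : R) (fun j => (p j)%:R) [set: T].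
rewrite cardsT => <-; rewrite sum_perm_onT; apply: ler_sum => s _.
under eq_bigr do rewrite setTD cycle_weight_pred.
rewrite /special_cycle; case: exists_inP => [[B0 B0s /andP[pB0 wB0]]|no]; last first.
  rewrite big1 // => B Bs; case: (boolP (p _)) => pB; rewrite ?mul0r // mul1r.
  by case: (boolP [forall C in _, _]) => // wB; case: no; exists B; rewrite // pB.
rewrite (bigD1 B0) //= pB0 wB0 big1 ?mulr1 ?addr0 // => B /andP[Bs nB].
case: forall_inP => [wB|]; last by rewrite mulr0.
have := wB B0; rewrite -setTD -(cycles_in_remove (imset_permT s) Bs).
by rewrite !inE eq_sym nB B0s (negbTE (pw _ pB0)) => /(_ isT).
Qed.

Definition no_short_cycle K s := [forall B in cycles_in s [set: T], (K < #|B|)%N].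

Lemma card_no_short_cycle K : (K < n)%N ->
  n`!%:R / (2 * K + 1)%:R <= #|no_short_cycle K|%:R :> R.
Proof.
move=> Kn; rewrite card_pred_sum.
under eq_bigr do rewrite -(@cycle_weight_pred (fun j => K < j)%N).
rewrite -sum_perm_onT -/(total_weight _ _) total_weightE cardsT ler_wpM2l ?ler0n //.
by have := exp_coef_long_ge R Kn; rewrite mul1r.
Qed.

Lemma no_short_cycle_invariant K s B : no_short_cycle K s ->
  s @: B = B -> (0 < #|B|)%N -> (K < #|B|)%N.
Proof.
move=> /forall_inP sK sB /card_gt0P[x xB].
have := subset_leq_card (porbit_subset sB xB); apply: leq_trans; apply: sK.
exact: imset_f.
Qed.

Definition fixed_point_no_short_cycle K := special_cycle (pred1 1%N) (fun j => K < j)%N.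

Lemma card_fixed_point_no_short_cycle K : (0 < K)%N -> (K.+1 < n)%N ->
  n`!%:R / (2 * K + 1)%:R <= #|fixed_point_no_short_cycle K|%:R :> R.
Proof.
move=> K0 Kn; apply: le_trans (card_special_cycle _); last first.
  by move=> j /eqP ->; rewrite -leqNgt.
rewrite ler_wpM2l ?ler0n //.
have n1 : (n.-1 < n)%N by lia.
(* Only i = n - 1 contributes: the removed cycle has length n - i = 1. *)
rewrite (bigD1 (Ordinal n1)) //= big1 ?addr0 => [|i ni]; last first.
  have : (n - i != 1)%N by apply: contra ni; rewrite -val_eqE /=; have := ltn_ord i; lia.
  by move/negbTE => ->; rewrite !mul0r.
have -> : (n - n.-1 = 1)%N by lia.
rewrite divr1 mul1r; have := @exp_coef_long_ge R K n.-1; rewrite mul1r.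
by apply; lia.
Qed.

Lemma fixed_point_no_short_cycleP K s : fixed_point_no_short_cycle K s ->
  exists a, s a = a /\
    forall B, a \notin B -> s @: B = B -> (0 < #|B|)%N -> (K < #|B|)%N.
Proof.
case/exists_inP=> _ /imsetP[a _ ->] /andP[/cards1P[b ab] /forall_inP sK].
have eab : b = a by apply/eqP; rewrite eq_sym -in_set1 -ab porbit_id.
exists a; split.
  have := mem_porbit s 1 a; rewrite expg1 ab eab => /set1P ->.
  by [].
move=> B aB sB /card_gt0P[x xB].
have xo : porbit s x \in cycles_in s (~: porbit s a).
  apply: imset_f; rewrite inE ab eab inE; apply: contraNneq aB => <-.
  exact: xB.
exact: leq_trans (sK _ xo) (subset_leq_card (porbit_subset sB xB)).
Qed.

Lemma card_odd_perm : (1 < n)%N -> (2 * #|[pred s : {perm T} | odd_perm s]| = n`!)%N.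
Proof.
move=> n1; have /card_gt1P[a [b [_ _ ab]]] : (1 < #|T|)%N := n1.
have : #|~: [set s : {perm T} | odd_perm s]| = #|[set s : {perm T} | odd_perm s]|.
  rewrite -(card_imset _ (mulgI (tperm a b))); apply: eq_card => s.
  rewrite !inE; apply/imsetP/idP => [[u + ->]|os].
    by rewrite !inE odd_mul_tperm ab addTb.
  exists (tperm a b * s)%g; last by rewrite mulgA tperm2 mul1g.
  by rewrite !inE odd_mul_tperm ab addTb negbK.
have -> : n`! = #|{perm T}|.
  rewrite -cardsT -card_perm; apply: eq_card => s.
  by rewrite [RHS]inE; apply: perm_onT.
rewrite -(cardsC [set s : {perm T} | odd_perm s]) => ->.
by rewrite addnn -mul2n; congr (_ * _)%N; apply: eq_card => s; rewrite inE.
Qed.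

(* With N the number of cycles of length at most [k], the indicator of having an
   invariant k-set is at most (3/4)^t (4/3)^N if N >= t, and at most 2^t (1/2)^N
   times the number of invariant k-sets if N <= t. *)
Lemma card_invariant_set k t : (0 < k)%N -> (k <= n)%N ->
  #|@has_invariant_set T k|%:R <=
  n`!%:R * ((3 / 4) ^+ t * exp_coef (short_weight (4 / 3) k) n +
     2 ^+ t * (exp_coef (short_weight (1 / 2) k) k * exp_coef (short_weight (1 / 2) k) (n - k)))
  :> R.
Proof.
move=> k0 kn; have half0 : 0 <= 1 / 2 :> R by lra.
have third1 : 1 <= 4 / 3 :> R by lra.
rewrite mulrDr (mulrCA _ ((3 / 4) ^+ t)) (mulrCA _ (2 ^+ t)).
have := sum_invariant_sets (short_weight (1 / 2 : R) k) (A := [set: T]) (k := k).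
have := total_weightE (short_weight (4 / 3 : R) k) [set: T].
rewrite cardsT => <- /(_ kn) <-; rewrite /total_weight !sum_perm_onT !mulr_sumr -big_split.
rewrite card_pred_sum; apply: ler_sum => s _ /=.
have weightE y : cycle_weight (short_weight y k) [set: T] s =
    y ^+ #|[set B in cycles_in s [set: T] | (#|B| <= k)%N]|.
  by rewrite /cycle_weight -big_mkcondr -[RHS]prodr_const; apply: eq_bigl => B; rewrite inE.
rewrite weightE; under eq_bigr do rewrite weightE; set N := #|_|.
have p1 : 0 <= (3 / 4 : R) ^+ t * (4 / 3) ^+ N by rewrite mulr_ge0 // exprn_ge0 //; lra.
have p2 (P : pred {set T}) : 0 <= (2 : R) ^+ t * \sum_(B | P B) (1 / 2) ^+ N.
  apply: mulr_ge0; first exact: exprn_ge0.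
  by apply: sumr_ge0 => B _; apply: exprn_ge0.
case: (boolP (has_invariant_set k s)) => [/existsP[B /andP[Bk sB]]|_]; last by rewrite addr_ge0.
have [tN|Nt] := leqP t N.
  rewrite -[X in X <= _]addr0 lerD // -(subnKC tN) exprD mulrA -exprMn.
  have -> : 3 / 4 * (4 / 3) = 1 :> R by field.
  by rewrite expr1n mul1r exprn_ege1 // ler1n.
rewrite -[X in X <= _]add0r lerD //.
apply: (@le_trans _ _ (2 ^+ t * (1 / 2) ^+ N)).
  rewrite -{1}(subnKC (ltnW Nt)) exprD mulrAC -exprMn.
  have -> : 2 * (1 / 2) = 1 :> R by field.
  by rewrite expr1n mul1r exprn_ege1 // ler1n.
rewrite ler_wpM2l ?exprn_ge0 // (bigD1 B) /=; last by rewrite subsetT sB Bk.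
by rewrite lerDl; apply: sumr_ge0 => C _; apply: exprn_ge0.
Qed.

End CycleTypeCounts.

(** * Density of the permutations with an invariant k-set *)

Section InvariantSetDensity.

Variable R : realFieldType.

(** Provides a power of 2 comparable to k^(1/30) without taking roots. *)
Lemma dyadic_scale k : (0 < k)%N ->
  exists v, (2 ^+ v) ^+ 30 <= k%:R :> R /\ k%:R <= (2 * 2 ^+ v) ^+ 30 :> R.
Proof.
move=> k0; exists (trunc_log 2 k %/ 30)%N.
have /andP[lo hi] := trunc_log_bounds (isT : (1 < 2)%N) k0.
rewrite -exprS -!exprM -!natrX !ler_nat; split.
  by apply: leq_trans lo; rewrite leq_exp2l // leq_divM.
apply: leq_trans (ltnW hi) _; rewrite leq_exp2l //; lia.
Qed.

(** With t = 27v and k^(1/3) at most (2 * 2^v)^10, the first term of [card_invariant_set] is a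
    constant times the v-th power of this left-hand side. *)
Lemma three_quarters_decay : (3 / 4) ^+ 27 * 2 ^+ 10 <= 1 / 2 :> R.
Proof.
have a0 : 0 <= (3 / 4 : R) by lra.
have a3 : (3 / 4 : R) ^+ 3 <= 211 / 500 by lra.
have a9 : (3 / 4 : R) ^+ 9 <= 19 / 250.
  rewrite (exprM _ 3 3); apply: le_trans (lerXn2r 3 _ _ a3) _.
  - by rewrite nnegrE exprn_ge0.
  - by rewrite nnegrE; lra.
  - by lra.
have -> : (3 / 4) ^+ 27 * 2 ^+ 10 = ((3 / 4) ^+ 9 * 8) ^+ 3 * 2 :> R.
  by move: (3 / 4) => y; ring.
have : ((3 / 4 : R) ^+ 9 * 8) ^+ 3 <= (152 / 250) ^+ 3.
  by rewrite lerXn2r // ?nnegrE ?mulr_ge0 ?exprn_ge0 //; lra.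
lra.
Qed.

(* For 2^(30v) <= k < 2^(30(v+1)) the threshold t = 27v makes both terms of
   [card_invariant_set] O(2^-v). *)
Lemma invariant_set_density : exists2 c : R, 0 < c &
  forall (T : finType) k, (0 < k)%N -> (k.*2 <= #|T|)%N ->
    (#|@has_invariant_set T k|%:R / #|T|`!%:R) ^+ 60 <= c / k%:R ^+ 2.
Proof.
pose c0 : R := 3 * 2 ^+ 10 + 2; have c00 : 0 < c0 by rewrite /c0; lra.
exists (c0 ^+ 60 * (2 ^+ 30) ^+ 2); first by rewrite mulr_gt0 // !exprn_gt0 //; lra.
move=> T k k0 kT; have [v [lo hi]] := dyadic_scale k0.
set x : R := 2 ^+ v in lo hi.
have x1 : 1 <= x by rewrite exprn_ege1 // ler1n.
have x0 : 0 < x by lra.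
have n0 : 0 < #|T|`!%:R :> R by rewrite ltr0n fact_gt0.
have kp : 0 < k%:R :> R by rewrite ltr0n.
have kn : (k <= #|T|)%N by lia.
have bound : #|@has_invariant_set T k|%:R / #|T|`!%:R <= c0 / x.
  rewrite ler_pdivrMr // mulrC.
  apply: le_trans (card_invariant_set R (27 * v) k0 kn) _.
  rewrite ler_wpM2l ?ler0n // /c0 (mulrDl (3 * 2 ^+ 10)) lerD //.
    have e0 m : 0 <= exp_coef (short_weight (4 / 3 : R) k) m.
      by apply: exp_coef_short_ge0; lra.
    have e3 : exp_coef (short_weight (4 / 3) k) #|T| <= 3 * (2 * x) ^+ 10.
      apply: le_trans (exp_coef_third_tail R k0 kn) _.
      have h3 := exp_coef_third_cube R (leqnn k).
      have k1 : 1 <= k%:R :> R by rewrite ler1n.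
      rewrite -(@ler_pXn2r _ 3) ?nnegrE ?mulr_ge0 ?exprn_ge0 ?e0 //; lra.
    rewrite exprM; apply: (@le_trans _ _ (((3 / 4) ^+ 27) ^+ v * (3 * (2 * x) ^+ 10))).
      by rewrite ler_wpM2l // !exprn_ge0 //; lra.
    have x10 : x ^+ 10 = (2 ^+ 10) ^+ v by rewrite /x -!exprM mulnC.
    rewrite (_ : _ * _ = 3 * 2 ^+ 10 * ((3 / 4) ^+ 27 * 2 ^+ 10) ^+ v); last first.
      rewrite [(2 * x) ^+ 10]exprMn x10 [(_ * 2 ^+ 10) ^+ v]exprMn.
      by rewrite [RHS]mulrCA !mulrA.
    have dec : ((3 / 4) ^+ 27 * 2 ^+ 10) ^+ v <= x^-1.
      have := three_quarters_decay; rewrite div1r => h.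
      rewrite /x -exprVn lerXn2r ?nnegrE ?invr_ge0 //.
      by rewrite mulr_ge0 // exprn_ge0 //; lra.
    by rewrite ler_wpM2l // mulr_ge0 // exprn_ge0.
  have kTk : (k <= #|T| - k)%N by lia.
  have tail := exp_coef_half_tail R k0 kTk.
  have sqr := exp_coef_half_sqr R (leqnn k).
  have e0 : 0 <= exp_coef (short_weight (1 / 2 : R) k) k.
    by apply: exp_coef_short_ge0; lra.
  have e0' : 0 <= exp_coef (short_weight (1 / 2 : R) k) (#|T| - k).
    by apply: exp_coef_short_ge0; lra.
  move: (exp_coef _ k) (exp_coef _ (#|T| - k)) tail sqr e0 e0' => e e' tail sqr e0 e0'.
  have k30 : x ^+ 30 * (e * e') <= 2.
    have : e * e' <= 2 / k%:R.
      apply: (@le_trans _ _ (2 * e ^+ 2)); first by rewrite expr2 mulrCA ler_wpM2l.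
      rewrite -(@ler_pM2l _ (1 / 2)) ?mulrA; last by lra.
      have -> : 1 / 2 * 2 = 1 :> R by lra.
      rewrite !mul1r; apply: le_trans sqr _.
      by rewrite div1r lef_pV2 ?posrE ?ltr0n // ler_nat.
    rewrite ler_pdivlMr // => h; apply: le_trans h; rewrite mulrC.
    by rewrite ler_wpM2l // mulr_ge0.
  (* The factor 2^(27v) is x^27, and x^27 * x <= x^30. *)
  rewrite mulnC exprM -/x ler_pdivlMr //; apply: le_trans k30.
  rewrite mulrAC -exprSr ler_wpM2r ?mulr_ge0 //.
  by rewrite ler_weXn2l.
(* As k <= (2x)^30, the sixtieth power of c0 / x is O(1 / k^2), which is summable. *)
rewrite ler_pdivlMr ?exprn_gt0 // (le_trans (y := (c0 / x) ^+ 60 * ((2 * x) ^+ 30) ^+ 2)) //.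
  apply: ler_pM; rewrite ?exprn_ge0 ?ler0n ?divr_ge0 //.
    by rewrite lerXn2r ?nnegrE ?divr_ge0 ?ler0n // ltW // divr_gt0.
  by rewrite lerXn2r ?nnegrE ?ler0n // ltW // exprn_gt0 // mulr_gt0.
rewrite exprMn [(2 * x) ^+ 30]exprMn [(_ * _) ^+ 2]exprMn.
have -> : x^-1 ^+ 60 = (x^-1 ^+ 30) ^+ 2 by rewrite -exprM.
have xx : (x^-1 ^+ 30) ^+ 2 * (x ^+ 30) ^+ 2 = 1.
  by rewrite -!exprMn mulVf ?gt_eqF // !expr1n.
by rewrite mulrACA xx mulr1.
Qed.

End InvariantSetDensity.

(** * Powers that move few points *)

Section SmallPower.

Lemma porbit_fixed_expg (T : finType) (s : {perm T}) i x :
  (((s ^+ i)%g) x == x) = (#|porbit s x| %| i)%N.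
Proof.
have per d : ((s ^+ (d * #|porbit s x|))%g) x = x.
  by rewrite mulnC expgM permX_fix // permX iter_porbit.
apply/eqP/idP => [fx|/dvdnP[d ->]]; last exact: per.
have O0 : (0 < #|porbit s x|)%N by rewrite lt0n card_porbit_neq0.
have lt := ltn_pmod i O0; move: fx; rewrite {1}(divn_eq i #|porbit s x|) expgD permM per.
rewrite permX -(nth_traject s lt) => e.
have := @nth_uniq _ x (traject s x #|porbit s x|) (i %% #|porbit s x|) 0.
rewrite size_traject e nth_traject // eqxx => /(_ lt O0 (uniq_traject_porbit s x)).
move/esym/eqP => m0.
by rewrite /dvdn m0.
Qed.

Definition has_small_power (T : finType) (s : {perm T}) :=
  [exists x in <[s]>%g, (x != 1%g) && (#|moved x|.-1 ^ 2 < #|T|.-1)%N].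

(** The 2-adic valuation of a least common multiple is the maximum of the valuations. *)
Lemma not_pfactor_dvdn_biglcmn (I : finType) (P : pred I) (F : I -> nat) a : (0 < a)%N ->
  (forall i, P i -> (0 < F i)%N) -> (forall i, P i -> ~~ (2 ^ a %| F i)%N) ->
  ~~ (2 ^ a %| \big[lcmn/1%N]_(i | P i) F i)%N.
Proof.
move=> a0 F0 Fa.
suff /andP[] : (0 < \big[lcmn/1%N]_(i | P i) F i)%N &&
    ~~ (2 ^ a %| \big[lcmn/1%N]_(i | P i) F i)%N by [].
apply: (big_ind (fun m => (0 < m)%N && ~~ (2 ^ a %| m)%N)).
- by rewrite dvdn1 -(expn0 2) eqn_exp2l // -lt0n a0.
- move=> x y /andP[x0 xa] /andP[y0 ya]; rewrite lcmn_gt0 x0 y0 /=.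
  move: xa ya; rewrite !pfactor_dvdn ?lcmn_gt0 ?x0 //.
  by rewrite logn_lcm // leq_max negb_or => -> ->.
- by move=> i Pi; rewrite F0 ?Fa.
Qed.

(* Raising [s] to the least common multiple of the other cycle lengths leaves
   only the special cycle: its length has too large a 2-adic valuation. *)
Lemma special_cycle_small_power (T : finType) a L (s : {perm T}) :
  (0 < a)%N -> (L.-1 ^ 2 < #|T|.-1)%N ->
  special_cycle (fun j => (2 ^ a %| j) && (j <= L))%N (fun j => ~~ (2 ^ a %| j)%N) s ->
  has_small_power s.
Proof.
move=> a0 LT /exists_inP[B Bs /andP[/andP[aB BL] /forall_inP others]].
pose r := \big[lcmn/1%N]_(C in cycles_in s (~: B)) #|C|.
have ra : ~~ (2 ^ a %| r)%N.
  apply: (not_pfactor_dvdn_biglcmn (P := mem (cycles_in s (~: B))) a0) => // C.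
  exact: cycles_in_neq0.
have [b _ Bb] := imsetP Bs.
apply/exists_inP; exists (s ^+ r)%g; first exact: mem_cycle.
apply/andP; split.
  apply: contraNneq ra => sr; apply: dvdn_trans aB _.
  by rewrite Bb -porbit_fixed_expg sr perm1.
apply: leq_ltn_trans LT; rewrite leq_sqr -!subn1 leq_sub2r //.
apply: leq_trans BL; apply: subset_leq_card; apply/subsetP => x.
rewrite inE; apply: contraNT => xB; rewrite porbit_fixed_expg.
have xC : porbit s x \in cycles_in s (~: B) by apply: imset_f; rewrite inE.
by rewrite /r (bigD1 _ xC) /= dvdn_lcml.
Qed.

End SmallPower.

(** * Harmonic sums and the density of permutations with a small power *)

Section HarmonicEstimates.

Variable R : realFieldType.

Definition harmonic_sum m : R := \sum_(l < m) l.+1%:R^-1.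

Lemma harmonic_sum_double m : (0 < m)%N ->
  1 / 2 <= harmonic_sum (m + m) - harmonic_sum m <= 1.
Proof.
move=> m0; rewrite /harmonic_sum big_split_ord /= addrAC subrr add0r.
have mp : 0 < m%:R :> R by rewrite ltr0n.
apply/andP; split.
  rewrite (le_trans (y := \sum_(l < m) (m + m)%:R^-1)) //.
    rewrite sumr_const card_ord -(mulr_natl _ m) ler_pdivlMr ?ltr0n ?addn_gt0 ?m0 //.
    by rewrite natrD; lra.
  apply: ler_sum => l _; rewrite lef_pV2 ?posrE ?ltr0n ?ler_nat ?addn_gt0 ?m0 //.
  by have := ltn_ord l; lia.
rewrite (le_trans (y := \sum_(l < m) m%:R^-1)) //.
  by apply: ler_sum => l _; rewrite lef_pV2 ?posrE ?ltr0n ?ler_nat ?addn_gt0 ?m0 //; lia.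
by rewrite sumr_const card_ord -[X in X <= _]mulr_natl divff ?gt_eqF.
Qed.

Lemma harmonic_sum_pow2 b : 1 + b%:R / 2 <= harmonic_sum (2 ^ b) <= 1 + b%:R.
Proof.
elim: b => [|b IH].
  by rewrite mul0r addr0 /harmonic_sum big_ord_recl big_ord0 invr1 addr0 lexx.
have := harmonic_sum_double (_ : 0 < 2 ^ b)%N; rewrite expn_gt0 => /(_ isT).
rewrite addnn -mul2n -expnS -(natr1 b); move: IH => /andP[? ?] /andP[? ?].
by apply/andP; split; lra.
Qed.

Lemma harmonic_sum_mono m m' : (m <= m')%N -> harmonic_sum m <= harmonic_sum m'.
Proof.
move=> le; rewrite /harmonic_sum (big_ord_widen m' (fun l => l.+1%:R^-1) le) big_mkcond.
by apply: ler_sum => l _; case: ifP => // _; rewrite invr_ge0 ler0n.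
Qed.

Lemma sum_divisible q n : (0 < q)%N ->
  \sum_(j < n) (q %| j.+1)%:R / j.+1%:R = harmonic_sum (n %/ q) / q%:R.
Proof.
move=> q0; elim: n => [|n IH]; first by rewrite div0n /harmonic_sum !big_ord0 mul0r.
rewrite big_ord_recr /= IH divnS //; case: (boolP (q %| n.+1)%N) => qn; last first.
  by rewrite mul0r addr0 add0n.
rewrite add1n /harmonic_sum big_ord_recr /= mulrDl; congr (_ + _).
rewrite mul1r -invfM -natrM; congr (_%:R^-1).
by rewrite -[n.+1 in LHS](divnK qn) divnS // qn add1n.
Qed.

Lemma sum_rev_index (f : nat -> R) n : \sum_(i < n) f (n - i)%N = \sum_(j < n) f j.+1.
Proof.
rewrite (reindex_inj rev_ord_inj) /=; apply: eq_bigr => i _.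
by rewrite subKn.
Qed.

(** Gives 2a <= M as soon as 2^a <= 8M + 11. *)
Lemma sqr_lt_exp2 M : (14 <= M)%N -> ((8 * M + 11) ^ 2 < 2 ^ M.+1)%N.
Proof.
elim: M => // M IH; rewrite leq_eqVlt => /predU1P[<-|M14].
  have -> : (2 ^ 15 = 2 ^ 7 * 2 ^ 7 * 2)%N by rewrite -expnD -expnSr.
  by rewrite -mulnn (leq_ltn_trans (leq_mul (_ : _ <= 2 ^ 7) (_ : _ <= 2 ^ 7))%N) // ltn_Pmulr.
have := IH M14; rewrite [(2 ^ M.+2)%N]expnS -!mulnn => lt; nia.
Qed.

(** With L = 2^M, at most the square root of n, and 2^a of order M, hence of order log n, one counts
    the permutations covered by [special_cycle_small_power]. *)
Lemma card_has_small_power (T : finType) M :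
  (14 <= M)%N -> (4 ^ M <= #|T|)%N -> (#|T| < 4 ^ M.+1)%N ->
  #|T|`!%:R / 72 <= #|@has_small_power T|%:R :> R.
Proof.
move=> M14 lo hi; set n := #|T| in lo hi *.
have [a [qlo qhi]] : exists a, (4 * M + 6 <= 2 ^ a)%N /\ (2 ^ a <= 8 * M + 11)%N.
  exists (trunc_log 2 (8 * M + 11)).
  have pos : (0 < 8 * M + 11)%N by lia.
  have /andP[l h] := trunc_log_bounds (isT : (1 < 2)%N) pos.
  by split=> //; rewrite expnS in h; lia.
have aM : (2 * a <= M)%N.
  rewrite leqNgt; apply/negP=> Ma; have := sqr_lt_exp2 M14; apply/negP; rewrite -leqNgt.
  apply: leq_trans (_ : (2 ^ (a * 2) <= _)%N); first by rewrite leq_exp2l // mulnC.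
  by rewrite expnM leq_sqr.
have a0 : (0 < a)%N by case: a qlo {qhi aM} => //; lia.
have q0 : (0 < 2 ^ a)%N by rewrite expn_gt0.
have M4 m : (4 ^ m = 2 ^ (2 * m))%N by rewrite expnM.
have Ln : (2 ^ M <= n)%N by apply: leq_trans lo; rewrite M4 leq_exp2l //; lia.
pose L := (2 ^ M)%N; rewrite -/L in Ln.
have qR : 0 < (2 ^ a)%:R :> R by rewrite ltr0n.
pose w : nat -> R := fun j => (~~ (2 ^ a %| j)%N)%:R.
(* On i points the expected number of cycles of length divisible by 2^a is at most (2M + 3) / 2^a <=
   1/2. *)
have e_half i : (i < n)%N -> 1 / 2 <= exp_coef w i.
  move=> ni; apply: le_trans (exp_coef_markov _ _); last first.
    by move=> j _; rewrite /w; case: (_ %| _)%N; rewrite ?lexx ?ler01.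
  have -> : \sum_(i0 < i) (1 - w (i - i0)%N) / (i - i0)%:R =
            \sum_(i0 < i) (2 ^ a %| i - i0)%N%:R / (i - i0)%:R.
    by apply: eq_bigr => k _; rewrite /w; case: (_ %| _)%N; rewrite ?subr0 ?subrr.
  rewrite (sum_rev_index (fun j => (2 ^ a %| j)%N%:R / j%:R)) sum_divisible //.
  rewrite lerBrDl -lerBrDr ler_pdivrMr //.
  apply: le_trans (harmonic_sum_mono (_ : _ <= 2 ^ (2 * M.+1))%N) _.
    by apply: leq_trans (leq_div _ _) _; rewrite -M4 ltnW // (ltn_trans ni).
  have /andP[_ h] := harmonic_sum_pow2 (2 * M.+1); apply: le_trans h _.
  have : (4 * M + 6)%:R <= (2 ^ a)%:R :> R by rewrite ler_nat.
  by rewrite natrD !natrM -(natr1 M); lra.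
apply: (@le_trans _ _ #|special_cycle (T := T) (fun j => (2 ^ a %| j) && (j <= L))%N
    (fun j => ~~ (2 ^ a %| j)%N)|%:R); last first.
  rewrite ler_nat; apply: subset_leq_card; apply/subsetP => s; rewrite !unfold_in.
  apply: special_cycle_small_power => //.
  have : (4 ^ M = L * L)%N by rewrite M4 mul2n -addnn expnD.
  have : (1 < L)%N by rewrite -(expn0 2) ltn_exp2l //; lia.
  move: lo; rewrite -/n -mulnn -!subn1; nia.
apply: le_trans (card_special_cycle R T _); last by move=> j /andP[->].
rewrite ler_wpM2l ?ler0n // -/n -/w.
apply: (@le_trans _ _ (\sum_(i < n)
    ((2 ^ a %| n - i) && (n - i <= L))%N%:R / (n - i)%:R * (1 / 2))).
  rewrite -mulr_suml.
  rewrite (sum_rev_index (fun j => ((2 ^ a %| j) && (j <= L))%N%:R / j%:R)).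
  have -> : \sum_(j < n) ((2 ^ a %| j.+1) && (j < L))%N%:R / j.+1%:R =
            \sum_(j < L) (2 ^ a %| j.+1)%N%:R / j.+1%:R :> R.
    rewrite (big_ord_widen n (fun j => (2 ^ a %| j.+1)%N%:R / j.+1%:R) Ln) [RHS]big_mkcond.
    by apply: eq_bigr => j _; case: (j < L)%N; rewrite ?andbT ?andbF ?mul0r.
  (* The sum is at least (1 + (M - a) / 2) / 2^a, which is at least 1/36 because 2a <= M and 2^a <=
     8M + 11. *)
  rewrite sum_divisible // -expnB //; last by lia.
  have /andP[h _] := harmonic_sum_pow2 (M - a).
  have : (2 ^ a)%:R <= 8 * M%:R + 11 :> R.
    by rewrite -natrM -natrD ler_nat.
  have : 2 * a%:R <= M%:R :> R by rewrite -natrM ler_nat.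
  have : 14 <= M%:R :> R by rewrite ler_nat.
  rewrite natrB in h; last by lia.
  move: (harmonic_sum _) h => H; move: ((2 ^ a)%:R : R) (M%:R : R) (a%:R : R) qR => q m x q_gt0.
  move=> hH m14 xm qm; rewrite mulrAC ler_pdivlMr //; lra.
apply: ler_sum => i _; rewrite ler_wpM2l ?divr_ge0 ?ler0n // e_half //.
Qed.

Lemma small_power_density :
  exists N, forall T : finType, (N <= #|T|)%N ->
    #|T|`!%:R / 72 <= #|@has_small_power T|%:R :> R.
Proof.
exists (4 ^ 14)%N => T NT; have T0 : (0 < #|T|)%N by apply: leq_trans NT; rewrite expn_gt0.
have /andP[lo hi] := trunc_log_bounds (isT : (1 < 4)%N) T0.
apply: card_has_small_power lo hi.
exact: trunc_log_max.
Qed.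

End HarmonicEstimates.

(** * Tuples all of whose conjugates generate the symmetric group *)

Section GoodTuples.

Variable T : finType.
Implicit Types (s t : {perm T}) (f : {ffun 'I_(4 + 60) -> {perm T}}).

Definition has_fixed_point s := [exists b, s b == b].

Definition special_preds K : seq (pred {perm T}) :=
  [:: no_short_cycle K; fixed_point_no_short_cycle K; @has_small_power T; @odd_perm T].

Definition good_family K (P : pred {perm T}) (i : 'I_(4 + 60)) : pred {perm T} :=
  match split i with
  | inl i' => nth xpred0 (special_preds K) i'
  | inr _ => P
  end.

(** Given the first conjunct, the second means that for each such [k] one of the last sixty entries
    has no invariant k-set. *)
Definition good_tuple K f :=
  (f \in family (good_family K has_fixed_point)) &&
  [forall k : 'I_(#|T|./2.+1), (K < k)%N ==>
     (f \notin family (good_family K [predI has_fixed_point & has_invariant_set k]))].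

(** The properties required of the entries survive conjugation, a fixed point [a] of [f i] becoming
    [h i a], so the criteria for 2-transitivity and for the full group apply to the conjugates. *)
Lemma good_tuple_generates K f (h : 'I_(4 + 60) -> {perm T}) (G : {group {perm T}}) :
  (2 < #|T|)%N -> good_tuple K f -> (forall i, (f i ^ h i)%g \in G) ->
  G :=: [set: {perm T}]%g.
Proof.
move=> T3 /andP[/familyP fP /forallP fQ] fG.
have special (i : 'I_4) : f (lshift 60 i) \in nth xpred0 (special_preds K) i.
  by have := fP (lshift 60 i); rewrite /good_family (unsplitK (inl i)).
have fix_pt (j : 'I_60) : has_fixed_point (f (rshift 4 j)).
  by have := fP (rshift 4 j); rewrite /good_family (unsplitK (inr j)).
have sp0 : no_short_cycle K (f (lshift 60 0)) := special 0.
have sp1 : fixed_point_no_short_cycle K (f (lshift 60 1)) := special 1.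
have sp2 : has_small_power (f (lshift 60 2%:R)) := special 2%:R.
have sp3 : odd_perm (f (lshift 60 3%:R)) := special 3%:R.
move: (lshift 60 0) (lshift 60 1) (lshift 60 2%:R) (lshift 60 3%:R) sp0 sp1 sp2 sp3.
move=> i0 i1 i2 i3 sp0 /fixed_point_no_short_cycleP[a [fa a_no]].
move=> /exists_inP[x xs /andP[x1 x_small]] sp3.
suff G2 : two_transitive G.
  apply: (two_transitive_jordan T3 G2 (s := (x ^ h i2)%g) _ _ _ (fG i3)).
  - have /cycleP[m ->] := xs; rewrite conjXg; apply: groupX; exact: fG.
  - by rewrite conjg_eq1.
  - by rewrite movedJ card_imset //; apply: perm_inj.
  - by rewrite odd_permJ.
apply: (two_transitive_no_invariant_set (K := K) (fG i0) _ (fG i1) (a := h i1 a)).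
- move=> k k0 kK; rewrite has_invariant_setJ; apply/existsPn => B.
  apply/negP => /andP[/eqP Bk /eqP fB].
  by have := no_short_cycle_invariant sp0 fB; rewrite Bk k0 ltnNge kK => /(_ isT).
- by rewrite permJ fa.
- move=> B aB B0 BK; apply/eqP => fB; have := a_no ((h i1)^-1%g @: B).
  rewrite card_imset; last exact: perm_inj.
  rewrite (ltnNge K) BK B0 /= => /(_ _ _ isT) no; suff : false by []. apply: no.
    by apply: contra aB => /imsetP[y yB ->]; rewrite permKV.
  rewrite -{2}fB -!imset_comp; apply: eq_imset => y /=.
  by rewrite -{2}[y](permKV (h i1)) permJ permK.
- move=> k Kk kT.
  have kl : (k < #|T|./2.+1)%N by rewrite ltnS geq_half_double.
  have /existsP[j jk] : [exists j : 'I_60, ~~ has_invariant_set k (f (rshift 4 j))].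
    apply: contraT => /existsPn all_inv; move: (fQ (Ordinal kl)).
    apply: contraTT => _.
    rewrite /= Kk /= negbK; apply/familyP => i; have := fP i; rewrite /good_family.
    case: splitP => // j ij; have -> : i = rshift 4 j by apply: val_inj.
    by rewrite !unfold_in /= => ->; have := all_inv j; rewrite negbK.
  exists (f (rshift 4 j) ^ h (rshift 4 j))%g; first exact: fG.
  split; last by rewrite has_invariant_setJ.
  have /existsP[b /eqP fb] := fix_pt j.
  by exists (h (rshift 4 j) b); rewrite permJ fb.
Qed.

Lemma card_good_family K (P : pred {perm T}) :
  #|family (good_family K P)| =
  (#|@no_short_cycle T K| * (#|@fixed_point_no_short_cycle T K| *
    (#|@has_small_power T| * #|[pred s : {perm T} | odd_perm s]|)) * #|P| ^ 60)%N.
Proof.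
rewrite card_family foldrE big_map big_enum big_split_ord /=; congr (_ * _)%N.
  under eq_bigr => i _ do rewrite /good_family (unsplitK (inl i)).
  by rewrite !big_ord_recl big_ord0 /= muln1.
under eq_bigr => j _ do rewrite /good_family (unsplitK (inr j)).
by rewrite prod_nat_const card_ord.
Qed.

End GoodTuples.

(** * Positive density of good tuples *)

Section GoodTupleDensity.

Variable R : archiRealFieldType.

Lemma sum_inv_sqr_le K n : (0 < K)%N ->
  \sum_(k < n | (K < k)%N) (k%:R ^+ 2)^-1 <= K%:R^-1 :> R.
Proof.
move=> K0; have Kp : 0 < K%:R :> R by rewrite ltr0n.
(* Telescoping with 1/k^2 <= 1/(k - 1) - 1/k; [maxn] covers the [n] for which the sum is still
   empty. *)
suff : \sum_(k < n | (K < k)%N) (k%:R ^+ 2)^-1 <= K%:R^-1 - (maxn K n.-1)%:R^-1 :> R.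
  by move/le_trans; apply; rewrite lerBlDr lerDl invr_ge0 ler0n.
elim: n => [|n IH]; first by rewrite big_ord0 maxn0 subrr.
rewrite big_mkcond big_ord_recr -big_mkcond /=; have [Kn|nK] := ltnP K n; last first.
  have e2 : maxn K n.-1 = K by lia.
  by rewrite addr0; rewrite e2 in IH.
have e2 : maxn K n.-1 = n.-1 by lia.
rewrite e2 in IH; move: IH; case: n Kn {e2} => // n Kn /= IH.
have n0 : 0 < n%:R :> R by rewrite ltr0n; lia.
apply: le_trans (lerD IH (lexx _)) _; rewrite -addrA lerD2l.
rewrite -(natr1 n); move: (n%:R : R) n0 => x x0.
have x1 : 0 < x + 1 by lra.
rewrite -subr_ge0.
have -> : - (x + 1)^-1 - (- x^-1 + ((x + 1) ^+ 2)^-1) = (x * (x + 1) ^+ 2)^-1.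
  by field; rewrite !gt_eqF.
by rewrite invr_ge0 mulr_ge0 ?exprn_ge0 // ltW.
Qed.

(** Already the permutations with exactly one fixed point, the case K = 1 of
    [card_fixed_point_no_short_cycle], have density at least 1/3. *)
Lemma density_fixed_point (T : finType) : (2 < #|T|)%N ->
  #|T|`!%:R / 3 <= #|@has_fixed_point T|%:R :> R.
Proof.
move=> T3; have := card_fixed_point_no_short_cycle R (isT : 0 < 1)%N T3.
move/le_trans; apply; rewrite ler_nat; apply: subset_leq_card; apply/subsetP => s.
rewrite !unfold_in => /fixed_point_no_short_cycleP[a [sa _]].
by apply/existsP; exists a; rewrite sa.
Qed.

(** From the family with fixed points one removes, for each k > K, the tuples whose last sixty
    entries all have an invariant k-set. The four special entries give a common factor [A], and the
    removed parts have total density at most c / K in the other sixty coordinates. *)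
Lemma good_tuple_density : exists K N, exists2 eps : R, 0 < eps &
  forall T : finType, (N <= #|T|)%N ->
    eps * (#|T|`! ^ 64)%:R <= #|@good_tuple T K|%:R.
Proof.
have [c c0 inv_le] := invariant_set_density R; have [N0 sp_le] := small_power_density R.
pose b : R := (1 / 3) ^+ 60; have b0 : 0 < b by rewrite exprn_gt0 //; lra.
(* Chosen so that the removed density c / K is at most half of the lower bound [b] for the
   fixed-point condition. *)
pose K := (Num.truncn (2 * c / b)).+1.
have Kc : c / K%:R <= b / 2.
  have : 2 * c / b < K%:R by rewrite truncnS_gt.
  rewrite ltr_pdivrMr // => h; rewrite ler_pdivrMr ?ltr0n //; lra.
exists K, (maxn N0 (K + 3)); exists ((2 * K + 1)%:R^-1 ^+ 2 / 72 / 2 * (b / 2)).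
  by rewrite !mulr_gt0 ?invr_gt0 ?exprn_gt0 ?invr_gt0 ?ltr0n //; lra.
move=> T; rewrite geq_max => /andP[N0T KT].
have T3 : (2 < #|T|)%N by lia.
set n := #|T| in N0T KT T3 *.
have nf : 0 < n`!%:R :> R by rewrite ltr0n fact_gt0.
pose A := (#|@no_short_cycle T K| * (#|@fixed_point_no_short_cycle T K| *
    (#|@has_small_power T| * #|[pred s : {perm T} | odd_perm s]|)))%N.
have A_ge : (2 * K + 1)%:R^-1 ^+ 2 / 72 / 2 * n`!%:R ^+ 4 <= A%:R :> R.
  have h0 : n`!%:R * (2 * K + 1)%:R^-1 <= #|@no_short_cycle T K|%:R :> R.
    by apply: card_no_short_cycle; rewrite -/n; lia.
  have h1 : n`!%:R * (2 * K + 1)%:R^-1 <= #|@fixed_point_no_short_cycle T K|%:R :> R.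
    by apply: card_fixed_point_no_short_cycle; rewrite -/n; lia.
  have h2 : n`!%:R * 72^-1 <= #|@has_small_power T|%:R :> R by apply: sp_le.
  have h3 : n`!%:R * 2^-1 <= #|[pred s : {perm T} | odd_perm s]|%:R :> R.
    rewrite -(card_odd_perm (T := T)) -/n; last by lia.
    by rewrite natrM mulrAC divff ?mul1r ?lexx ?pnatr_eq0.
  have -> : (2 * K + 1)%:R^-1 ^+ 2 / 72 / 2 * n`!%:R ^+ 4 =
      (n`!%:R * (2 * K + 1)%:R^-1) * ((n`!%:R * (2 * K + 1)%:R^-1) *
        ((n`!%:R * 72^-1) * (n`!%:R * 2^-1))) :> R by ring.
  by rewrite /A !natrM !ler_pM // !(mulr_ge0, invr_ge0, ler0n).
have fix_ge : b * n`!%:R ^+ 60 <= (#|@has_fixed_point T| ^ 60)%:R.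
  rewrite natrX /b -exprMn lerXn2r ?nnegrE ?mulr_ge0 ?invr_ge0 ?ler0n //.
  by rewrite mul1r mulrC; apply: density_fixed_point.
have inv_k k : (K < k)%N -> (k < n./2.+1)%N ->
    (#|[predI @has_fixed_point T & has_invariant_set k]| ^ 60)%:R <=
    c * n`!%:R ^+ 60 * (k%:R ^+ 2)^-1 :> R.
  move=> Kk kn; have k0 : (0 < k)%N by lia.
  have := inv_le T k k0 (_ : k.*2 <= #|T|)%N; rewrite -geq_half_double -ltnS kn => /(_ isT).
  rewrite expr_div_n ler_pdivrMr ?exprn_gt0 // => h.
  rewrite mulrAC; apply: le_trans h; rewrite natrX lerXn2r ?nnegrE ?ler0n // ler_nat.
  by apply: subset_leq_card; apply/subsetP => s /andP[].
have count : #|family (good_family K (@has_fixed_point T))|%:R <=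
    #|@good_tuple T K|%:R + \sum_(k < n./2.+1 | (K < k)%N)
      #|family (good_family K [predI @has_fixed_point T & has_invariant_set k])|%:R :> R.
  rewrite -natr_sum -natrD ler_nat.
  pose Q (k : 'I_(n./2.+1)) :=
    family (good_family K [predI @has_fixed_point T & has_invariant_set k]).
  apply: (@leq_trans (\sum_(f in family (good_family K (@has_fixed_point T)))
     (good_tuple K f + \sum_(k < n./2.+1 | (K < k)%N) (f \in Q k)))%N).
    rewrite -sum1_card; apply: leq_sum => f fP.
    case: (boolP (good_tuple K f)) => // ; rewrite /good_tuple fP /= => /forallPn[k].
    rewrite negb_imply negbK => /andP[Kk fk].
    have fQ : f \in Q k := fk.
    by rewrite (bigD1 k) //= fQ add0n addn_gt0.
  rewrite big_split exchange_big /= leq_add //.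
    rewrite -sum1_card big_mkcond [X in (_ <= X)%N]big_mkcond leq_sum // => f _.
    by case: ifP => _ //; rewrite unfold_in; case: (good_tuple K f).
  apply: leq_sum => k Kk; rewrite -[X in (_ <= X)%N]sum1_card.
  rewrite big_mkcond [X in (_ <= X)%N]big_mkcond leq_sum // => f _.
  by case: ifP => _; rewrite /Q; case: (f \in _).
rewrite card_good_family -/A natrM in count.
have Qsum : \sum_(k < n./2.+1 | (K < k)%N)
      #|family (good_family K [predI @has_fixed_point T & has_invariant_set k])|%:R <=
      A%:R * (n`!%:R ^+ 60 * (b / 2)).
  apply: (@le_trans _ _ (\sum_(k < n./2.+1 | (K < k)%N)
      A%:R * (c * n`!%:R ^+ 60 * (k%:R ^+ 2)^-1))).
    apply: ler_sum => k Kk; rewrite card_good_family -/A natrM ler_wpM2l ?ler0n //.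
    exact: inv_k.
  rewrite -mulr_sumr ler_wpM2l ?ler0n // -mulr_sumr mulrAC mulrC ler_wpM2l ?exprn_ge0 ?ler0n //.
  apply: le_trans Kc; rewrite ler_wpM2l ?(ltW c0) //.
  exact: sum_inv_sqr_le.
have : A%:R * (n`!%:R ^+ 60 * (b / 2)) <= #|@good_tuple T K|%:R.
  have := ler_wpM2l (ler0n R A) fix_ge; move: count Qsum.
  move: (\sum_(_ < _ | _) _) (n`!%:R ^+ 60) => S N; lra.
apply: le_trans; rewrite natrX (exprD _ 4 60) mulrACA [b / 2 * _]mulrC.
by rewrite ler_wpM2r // mulr_ge0 ?exprn_ge0 ?ler0n // ltW // divr_gt0.
Qed.

End GoodTupleDensity.

(** * Invariable generation in finite groups *)

Section InvariableGeneration.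

Variable gT : finGroupType.

(** Boolean and on finite functions, so that such tuples can be counted. *)
Definition invariably_generates m (f : {ffun 'I_m -> gT}) :=
  [forall h : {ffun 'I_m -> gT},
    (<<[set f i ^ h i | i : 'I_m]>> == [set: gT])%g].

(* Jordan's theorem: the conjugates of [H] cover at most |G : H| (|H| - 1)
   non-identity elements. *)
Lemma class_support_full (G H : {group gT}) :
  H \subset G -> class_support H G = G -> H :=: G.
Proof.
move=> HG HT; pose i := #|G : H|%g.
have cov : (#|G|.-1 <= i * #|H|.-1)%N.
  have -> : (#|G|.-1 = #|(class_support H G)^#|)%g.
    by rewrite HT (cardsD1 1%g G) group1.
  rewrite class_supportD1; apply: leq_trans (leq_card_cover _) _.
  apply: leq_trans (_ : #|H^# :^: G|%g * #|H|.-1 <= _)%N.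
    rewrite -sum_nat_const; apply: leq_sum => _ /imsetP[x _ ->].
    by rewrite cardJg (cardsD1 1%g H) group1.
  rewrite leq_mul2r card_conjugates; apply/orP; right.
  apply: dvdn_leq; first exact: indexg_gt0.
  have nH : H \subset 'N(H^#)%g by rewrite normD1 normG.
  by apply: indexgS; rewrite subsetI HG; exact: nH.
have H0 := cardG_gt0 H; have G0 := cardG_gt0 G.
have LT := Lagrange HG; rewrite -/i in LT.
rewrite -LT in cov G0; apply: index1g HG _.
rewrite -/i; have i0 : (0 < i)%N by move: G0; rewrite muln_gt0 => /andP[].
clearbody i; move: H0 i0 cov {LT G0}; case: #|H| => // h _ i0.
by rewrite mulSn mulnC /=; lia.
Qed.

Lemma invariably_generatesP m (f : {ffun 'I_m -> gT}) :
  (forall (h : 'I_m -> gT) (G : {group gT}),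
     (forall i, (f i ^ h i)%g \in G) -> G :=: [set: gT]%g) ->
  invariably_generates f.
Proof.
move=> fG; apply/forallP => h; apply/eqP.
by apply: (fG h <<_>>%G) => i; apply: mem_gen; apply: imset_f.
Qed.

(** A subgroup containing a conjugate of every element is the whole group by [class_support_full].
    This handles the small symmetric groups. *)
Lemma enum_invariably_generates :
  invariably_generates [ffun i : 'I_#|gT| => enum_val i].
Proof.
apply: invariably_generatesP => h G hG.
apply: (@class_support_full [set: gT]%G); first exact: subsetT.
apply/eqP; rewrite eqEsubset subsetT; apply/subsetP => x _.
have := hG (enum_rank x); rewrite ffunE enum_rankK => xG.
by rewrite -[x](conjgK (h (enum_rank x))) memJ_class_support ?inE.
Qed.

End InvariableGeneration.

Lemma invariable_generation_density (R : archiRealFieldType) :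
  exists N, exists2 eps : R, 0 < eps & forall n, (N <= n)%N ->
    eps * (#|'S_n| ^ (4 + 60))%:R <=
      #|[pred f : {ffun 'I_(4 + 60) -> 'S_n} | invariably_generates f]|%:R.
Proof.
have [K [N [eps eps0 le]]] := good_tuple_density R.
exists (maxn N 3), eps => // n; rewrite geq_max => /andP[Nn n3].
have := le 'I_n; rewrite card_ord card_Sn => /(_ Nn) {}le.
apply: le_trans le _; rewrite ler_nat; apply: subset_leq_card.
apply/subsetP => f; rewrite !unfold_in => good_f; apply: invariably_generatesP => h G.
by apply: good_tuple_generates good_f; rewrite card_ord.
Qed.

(** * Sums of powers against a geometric sequence *)

Section PowerGeometricSum.

Variable R : realFieldType.

(** The sum is a partial sum of the series of (1 - x)^(-k-1). By Pascal's rule, multiplying by 1 - x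
    lowers [k] by one, up to a boundary term that is at most 0. *)
Lemma sum_bin_geometric k (x : R) N : 0 <= x < 1 ->
  (1 - x) ^+ k.+1 * \sum_(j < N) 'C(j + k, k)%:R * x ^+ j <= 1.
Proof.
move=> /andP[x0 x1]; have y0 : 0 < 1 - x by lra.
elim: k => [|k IH].
  suff -> : (1 - x) ^+ 1 * \sum_(j < N) 'C(j + 0, 0)%:R * x ^+ j = 1 - x ^+ N.
    by rewrite lerBlDr lerDl exprn_ge0.
  elim: N => [|N IH]; first by rewrite big_ord0 mulr0 subrr.
  by rewrite big_ord_recr mulrDr IH /= bin0 (exprS x N) expr1; ring.
apply: le_trans IH; rewrite exprSr -mulrA ler_wpM2l ?exprn_ge0 ?(ltW y0) //.
suff -> : (1 - x) * \sum_(j < N) 'C(j + k.+1, k.+1)%:R * x ^+ j =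
    \sum_(j < N) 'C(j + k, k)%:R * x ^+ j - 'C(N + k, k.+1)%:R * x ^+ N.
  by rewrite lerBlDr lerDl mulr_ge0 ?exprn_ge0.
elim: N => [|N IH]; first by rewrite !big_ord0 mulr0 bin_small // mul0r subrr.
rewrite !big_ord_recr mulrDr IH /= addnS addSn binS natrD (exprS x N); ring.
Qed.

(** The right-hand side is (j + 1) ... (j + k). This reduces moments to [sum_bin_geometric]. *)
Lemma powS_le_bin j k : (j.+1 ^ k <= k`! * 'C(j + k, k))%N.
Proof.
rewrite mulnC bin_ffact; elim: k => // k IH.
by rewrite expnS addnS ffactSS leq_mul //; lia.
Qed.

Lemma sum_pow_geometric k m (eps : R) N : 0 < eps <= 1 ->
  \sum_(j < N) ((j.+1 * m) ^ k)%:R * (1 - eps) ^+ j <= (m ^ k * k`!)%:R / eps ^+ k.+1.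
Proof.
move=> /andP[e0 e1]; have ek : 0 < eps ^+ k.+1 by rewrite exprn_gt0.
have x0 : 0 <= 1 - eps by lra.
rewrite ler_pdivlMr // mulrC.
apply: (@le_trans _ _ (eps ^+ k.+1 *
    ((m ^ k * k`!)%:R * \sum_(j < N) 'C(j + k, k)%:R * (1 - eps) ^+ j))).
  rewrite ler_wpM2l ?(ltW ek) // mulr_sumr; apply: ler_sum => j _.
  rewrite mulrA ler_wpM2r ?exprn_ge0 // -natrM ler_nat expnMn mulnC -mulnA.
  by rewrite leq_mul2l powS_le_bin orbT.
rewrite mulrCA ler_piMr ?ler0n //.
have x1 : 0 <= 1 - eps < 1 by lra.
by have := sum_bin_geometric k N x1; rewrite subKr.
Qed.

End PowerGeometricSum.

From mathcomp Require Import all_classical all_reals all_analysis measurable_realfun.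

(** * Tails and moments of the waiting time *)

Section WaitingTime.

Local Open Scope classical_set_scope.
Local Open Scope ereal_scope.

Context d (T : measurableType d) (R : realType) (P : probability T R).
Variables (gT : finGroupType) (X : nat -> T -> gT).
Hypothesis X_iid : iid_uniform P X.
Variable m : nat.

Definition block (j : nat) (w : T) : {ffun 'I_m -> gT} :=
  [ffun i : 'I_m => X (j * m + i)%N w].

Definition bad_blocks J : set T :=
  [set w | forall j, (j < J)%N -> ~~ invariably_generates (block j w)].

Definition cylinder J (h : {ffun 'I_J -> {ffun 'I_m -> gT}}) : set T :=
  [set w | forall j : 'I_J, block j w = h j].

(** Brings the event into the form required by [mutually_independent], an intersection of conditions
    on single picks. *)
Lemma cylinderE J (h : {ffun 'I_J -> {ffun 'I_m -> gT}}) :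
  cylinder h = \bigcap_(n in [set` iota 0 (J * m)])
    (X n @^-1` [set g | forall (j : 'I_J) (i : 'I_m), (j * m + i)%N = n -> g = h j i]).
Proof.
apply/seteqP; split=> [w hw n _ j i <-|w hw j].
  by rewrite -(hw j) ffunE.
apply/ffunP => i; rewrite ffunE; apply: (hw _ _ j i erefl) => /=.
rewrite mem_iota add0n /=; apply: leq_trans (leq_mul (ltn_ord j) (leqnn m)).
by rewrite mulSn addnC ltn_add2r.
Qed.

Lemma measurable_cylinder J (h : {ffun 'I_J -> {ffun 'I_m -> gT}}) :
  measurable (cylinder h).
Proof.
rewrite cylinderE; apply: fin_bigcap_measurable; first exact: finite_seq.
by move=> n _; apply: (iid_random_element X_iid).
Qed.

Lemma probability_cylinder J (h : {ffun 'I_J -> {ffun 'I_m -> gT}}) :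
  P (cylinder h) = ((#|gT|%:R^-1 : R) ^+ (J * m))%:E.
Proof.
rewrite cylinderE (iid_independent X_iid) ?iota_uniq //.
transitivity (\prod_(n <- iota 0 (J * m)) (#|gT|%:R^-1 : R)%:E).
  apply: eq_big_seq => n; rewrite mem_iota add0n => /andP[_ nJ].
  have m0 : (0 < m)%N by case: (m) nJ => //; rewrite muln0.
  have jJ : (n %/ m < J)%N by rewrite ltn_divLR.
  (* Euclidean division by [m] gives the only block and position of pick [n], so the condition on it
     is that it equals [g]. *)
  pose g := h (Ordinal jJ) (Ordinal (ltn_pmod n m0)).
  rewrite -(iid_uniformly_distributed X_iid n g); congr (P (_ @^-1` _)).
  apply/seteqP; split=> [x /= hx|x /= -> j i jin].
    by apply: hx => /=; rewrite -divn_eq.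
  rewrite /g; congr (h _ _); apply: val_inj => /=.
    by rewrite -jin divnMDl // divn_small ?addn0.
  by rewrite -jin modnMDl modn_small.
rewrite -[in RHS](size_iota 0 (J * m)).
elim: (iota _ _) => [|n s IH]; first by rewrite big_nil expr0.
by rewrite big_cons IH /= exprS EFinM.
Qed.

Definition bad_tuples : pred {ffun 'I_m -> gT} :=
  [pred f | ~~ invariably_generates f].

Lemma bad_blocksE J :
  bad_blocks J = \bigcup_(h in [set` enum (ffun_on bad_tuples)]) @cylinder J h.
Proof.
apply/seteqP; split=> [w wJ|w [h]].
  exists [ffun j : 'I_J => block j w]; last by move=> j; rewrite ffunE.
  rewrite /= mem_enum; apply/ffun_onP => j; rewrite ffunE inE.
  exact: wJ.
rewrite /= mem_enum => /ffun_onP hbad hw j jJ.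
by have := hbad (Ordinal jJ); rewrite inE -(hw (Ordinal jJ)).
Qed.

Lemma measurable_bad_blocks J : measurable (bad_blocks J).
Proof.
rewrite bad_blocksE; apply: fin_bigcup_measurable; first exact: finite_seq.
by move=> h _; apply: measurable_cylinder.
Qed.

(* Union bound over the cylinders prescribing [J] bad blocks. *)
Lemma probability_bad_blocks J (eps : R) :
  (eps * (#|gT| ^ m)%:R <= #|[pred f : {ffun 'I_m -> gT} | invariably_generates f]|%:R)%R ->
  P (bad_blocks J) <= ((1 - eps) ^+ J)%:E.
Proof.
move=> le_eps; rewrite bad_blocksE bigcup_seq.
have boole (s : seq {ffun 'I_J -> {ffun 'I_m -> gT}}) :
    P (\big[setU/set0]_(h <- s) cylinder h) <= ((size s)%:R * (#|gT|%:R^-1) ^+ (J * m))%:E.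
  elim: s => [|h s IH]; first by rewrite big_nil measure0 mul0r.
  rewrite big_cons; set B := \big[_/_]_(_ <- s) _ in IH *.
  have mB : measurable B by apply: bigsetU_measurable => *; apply: measurable_cylinder.
  apply: (@le_trans _ _ (P (cylinder h) + P B)).
    by apply: measureU2 => //; apply: measurable_cylinder.
  rewrite /= -add1n natrD mulrDl mul1r EFinD leeD //.
  by rewrite probability_cylinder.
have g0 : (0 < #|gT|%:R :> R)%R.
  by rewrite ltr0n; apply/card_gt0P; exists 1%g.
have bad_le : (#|bad_tuples|%:R * #|gT|%:R^-1 ^+ m <= 1 - eps)%R.
  rewrite exprVn ler_pdivrMr ?exprn_gt0 // -natrX mulrBl mul1r lerBrDr.
  have cE : (#|bad_tuples| +
      #|[pred f : {ffun 'I_m -> gT} | invariably_generates f]| = #|gT| ^ m)%N.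
    rewrite addnC -[X in _ = (_ ^ X)%N](card_ord m) -card_ffun.
    by rewrite -(cardC [pred f : {ffun 'I_m -> gT} | invariably_generates f]).
  by rewrite -[X in (_ <= X%:R)%R]cE natrD lerD2l.
have eps1 : (0 <= 1 - eps)%R.
  by apply: le_trans bad_le; rewrite mulr_ge0 ?exprn_ge0 ?invr_ge0 ?ler0n.
(* There are |bad_tuples|^J cylinders of probability |gT|^(-Jm) each, which gives the J-th power of
   the density of bad tuples. *)
apply: le_trans (boole _) _; rewrite lee_fin -cardE card_ffun_on card_ord.
rewrite natrX mulnC exprM -exprMn lerXn2r ?nnegrE ?mulr_ge0 ?exprn_ge0 ?invr_ge0 ?ler0n //.
Qed.

Lemma waiting_time_ge0 w : 0 <= waiting_time R X w.
Proof. by apply/ereal_infP => _ [n _ <-]; rewrite lee_fin ler0n. Qed.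

(** Block [j] ends with pick number (j + 1) m, and any representatives of the classes up to there
    include conjugates of all its entries. *)
Lemma waiting_time_le_block j w : (0 < m)%N ->
  invariably_generates (block j w) -> waiting_time R X w <= (j.+1 * m)%:R%:E.
Proof.
move=> m0 /forallP gen; apply: ereal_inf_lbound; exists (j.+1 * m)%N => //.
split; first by rewrite muln_gt0.
move=> g gX; apply/eqP; rewrite finset.eqEsubset finset.subsetT /=.
have lt (i : 'I_m) : (j * m + i < j.+1 * m)%N by rewrite mulSn addnC ltn_add2r.
have /fin_all_exists[h hg] (i : 'I_m) :
    exists y, tnth g (Ordinal (lt i)) = (X (j * m + i)%N w ^ y)%g.
  have := gX (Ordinal (lt i)); rewrite tnth_mktuple /conj_class => /imsetP[y _ ->].
  by exists y.
have /eqP <- := gen [ffun i => h i].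
apply: genS; apply/fintype.subsetP => _ /imsetP[i _ ->].
by rewrite !ffunE -hg inE mem_tnth.
Qed.

(** If [j] is the first generating block, the term of index [j] alone is at least the left-hand
    side. If there is no such block, every term is at least 1 and the series is infinite. *)
Lemma waiting_time_expe_le k w : (0 < m)%N ->
  waiting_time R X w ^+ k <=
  \sum_(0 <= j <oo) (((j.+1 * m) ^ k)%:R * \1_(bad_blocks j) w : R)%:E.
Proof.
move=> m0; pose u j : \bar R := (((j.+1 * m) ^ k)%:R * \1_(bad_blocks j) w : R)%:E.
rewrite -[leRHS]/(\sum_(0 <= j <oo) u j).
have u0 n : 0 <= u n by rewrite /u lee_fin mulr_ge0 ?ler0n.
have partial N : \sum_(0 <= j < N) u j <= \sum_(0 <= j <oo) u j.
  exact: nneseries_lim_ge.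
have [|none] := pselect (exists j, invariably_generates (block j w)).
  move=> good; case: (ex_minnP good) => j gen_j min_j.
  have bad_j : bad_blocks j w.
    by move=> i ij; apply/negP => /min_j; rewrite leqNgt ij.
  have tau_le := waiting_time_le_block m0 gen_j; have tau_ge := waiting_time_ge0 w.
  apply: le_trans (partial j.+1); rewrite big_nat_recr //=.
  apply: (@le_trans _ _ (u j)); last by rewrite leeDr // sume_ge0.
  rewrite /u indicE mem_set // mulr1.
  case: waiting_time tau_le tau_ge => // t; rewrite !lee_fin => t_le t_ge.
  by rewrite -EFin_expe lee_fin natrX lerXn2r ?nnegrE ?ler0n.
have u1 j : 1 <= u j.
  rewrite /u indicE mem_set ?mulr1; last first.
    by move=> i _; apply/negP => gen_i; apply: none; exists i.
  by rewrite lee_fin ler1n expn_gt0 muln_gt0 m0.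
rewrite [leRHS](_ : _ = +oo) ?leey //; apply: eq_infty => r.
apply: le_trans (partial (Num.truncn `|r|).+1).
apply: (@le_trans _ _ (\sum_(0 <= j < (Num.truncn `|r|).+1) 1)); last exact: lee_sum.
rewrite sumEFin sumr_const_nat subn0 lee_fin.
by apply: le_trans (ler_norm r) _; rewrite ltW // truncnS_gt.
Qed.

(* Unlike [ge0_le_integral], this needs no measurability of [f] and [g]. *)
Lemma le_integral_ge0 (f g : T -> \bar R) : (forall x, 0 <= f x) ->
  (forall x, f x <= g x) -> \int[P]_x f x <= \int[P]_x g x.
Proof.
move=> f0 fg; have g0 x : 0 <= g x by apply: le_trans (fg x).
rewrite !ge0_integralTE //; apply: ereal_sup_le => _ [h hf <-].
by exists h => // x; apply: le_trans (hf x) (fg x).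
Qed.

(** Integrating [waiting_time_expe_le] termwise and using the geometric bound on the probability of
    [bad_blocks j] leaves the sum of [sum_pow_geometric]. *)
Lemma integral_waiting_time_expe_le k (eps : R) : (0 < m)%N -> (0 < eps)%R ->
  (eps * (#|gT| ^ m)%:R <= #|[pred f : {ffun 'I_m -> gT} | invariably_generates f]|%:R)%R ->
  \int[P]_w (waiting_time R X w ^+ k) <= ((m ^ k * k`!)%:R / eps ^+ k.+1)%:E.
Proof.
move=> m0 eps0 le_eps.
have gm0 : (0 < (#|gT| ^ m)%:R :> R)%R.
  by rewrite ltr0n expn_gt0; apply/orP; left; apply/card_gt0P; exists 1%g.
have eps1 : (eps <= 1)%R.
  rewrite -(ler_pM2r gm0) mul1r; apply: le_trans le_eps _; rewrite ler_nat.
  by apply: leq_trans (max_card _) _; rewrite card_ffun card_ord.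
apply: le_trans (le_integral_ge0 (fun w => expe_ge0 _ (waiting_time_ge0 w))
  (fun w => waiting_time_expe_le k w m0)) _.
pose u j w : \bar R := (((j.+1 * m) ^ k)%:R * \1_(bad_blocks j) w : R)%:E.
have mu_ j : measurable_fun [set: T] (u j).
  apply/measurable_EFinP; apply: measurable_funM => //.
  exact/measurable_indicP/measurable_bad_blocks.
have u0 j w : [set: T] w -> 0 <= u j w.
  by move=> _; rewrite lee_fin mulr_ge0 ?ler0n.
rewrite (integral_nneseries P measurableT mu_ u0).
apply: (@le_trans _ _ (\sum_(0 <= j <oo) (((j.+1 * m) ^ k)%:R * (1 - eps) ^+ j : R)%:E)).
  apply: lee_nneseries => [j _ _|j _].
    by apply: integral_ge0 => w; apply: u0.
  rewrite /u; under eq_integral do rewrite EFinM.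
  have m1 : measurable_fun [set: T] (fun x => (\1_(bad_blocks j) x : R)%:E).
    by apply/measurable_EFinP; apply/measurable_indicP/measurable_bad_blocks.
  rewrite ge0_integralZl ?lee_fin ?ler0n //.
  rewrite (integral_indic P measurableT (measurable_bad_blocks j)) setIT EFinM.
  by apply: lee_wpmul2l; [rewrite lee_fin ler0n|apply: probability_bad_blocks].
apply: lime_le; first apply: is_cvg_nneseries => j _ _.
  by rewrite lee_fin mulr_ge0 ?ler0n // exprn_ge0 // subr_ge0.
apply: nearW => N; rewrite sumEFin lee_fin big_mkord.
by apply: sum_pow_geometric; rewrite eps0.
Qed.

End WaitingTime.

(** For n >= N blocks of 64 picks succeed with probability at least [eps]. Each of the finitely many
    smaller n has its own constant, from blocks of n! picks, and all constants are added. *)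
Lemma symmetric_waiting_time_moment (R : realType) (k : nat) :
  exists c_k : R, (0 <= c_k)%R /\
    forall (n : nat) (d : measure_display) (T : measurableType d)
      (P : probability T R) (X : nat -> T -> 'S_n), iid_uniform P X ->
      (\int[P]_w (waiting_time R X w ^+ k) <= c_k%:E)%E.
Proof.
have [N [eps eps0 dense]] := invariable_generation_density R.
pose B m (e : R) : R := (m ^ k * k`!)%:R / e ^+ k.+1.
have B0 m e : 0 < e -> 0 <= B m e.
  by move=> e0; rewrite divr_ge0 ?ler0n ?exprn_ge0 // ltW.
(* The probability of a single tuple of length |S_n|; the enumeration of the group is one that
   generates. *)
pose e_ n : R := (#|'S_n| ^ #|'S_n|)%:R^-1.
have S0 n : (0 < #|'S_n|)%N by rewrite card_Sn fact_gt0.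
have e0 n : 0 < e_ n by rewrite invr_gt0 ltr0n expn_gt0 S0.
exists (B (4 + 60)%N eps + \sum_(n < N) B #|'S_n| (e_ n)); split.
  by rewrite addr_ge0 ?B0 // sumr_ge0 // => n _; rewrite B0.
move=> n d T P X X_iid; have [nN|Nn] := ltnP n N.
  apply: le_trans (integral_waiting_time_expe_le X_iid k (S0 n) (e0 n) _) _.
    rewrite mulVf ?pnatr_eq0 -?lt0n ?expn_gt0 ?S0 // ler1n.
    by apply/card_gt0P; exists [ffun i => enum_val i]; apply: enum_invariably_generates.
  rewrite lee_fin (bigD1 (Ordinal nN)) //= addrCA lerDl addr_ge0 ?B0 //.
  by rewrite sumr_ge0 // => i _; rewrite B0.
apply: le_trans (integral_waiting_time_expe_le X_iid k _ eps0 (dense n Nn)) _ => //.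
by rewrite lee_fin lerDl sumr_ge0 // => i _; rewrite B0.
Qed.

Theorem theorem1p1 (R : realType) :
  (exists c : R, (0 < c)%R /\
     forall n : nat, (1 <= n)%N ->
     forall (d : measure_display) (T : measurableType d)
       (P : probability T R) (X : nat -> T -> 'S_n),
       iid_uniform P X ->
       (\int[P]_w waiting_time R X w <= c%:E)%E)
  /\
  (forall k : nat, (1 <= k)%N ->
   exists c_k : R, (0 <= c_k)%R /\
     forall n : nat, (1 <= n)%N ->
     forall (d : measure_display) (T : measurableType d)
       (P : probability T R) (X : nat -> T -> 'S_n),
       iid_uniform P X ->
       (\int[P]_w (waiting_time R X w ^+ k) <= c_k%:E)%E).
Proof.
split=> [|k _].
  have [c [c0 le_c]] := symmetric_waiting_time_moment R 1.
  (* Adding 1 makes the nonnegative constant positive. *)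
  exists (c + 1); split=> [|n _ d T P X X_iid]; first by rewrite ltr_wpDl.
  by apply: le_trans (le_c n d T P X X_iid) _; rewrite lee_fin lerDl.
have [c [c0 le_c]] := symmetric_waiting_time_moment R k.
by exists c; split=> // n _ d T P X; apply: le_c.
Qed.
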